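(* (a) Let $S$ be a finite inverse semigroup with identity element. Then the semigroup algebra $\mathbb{C}(S)$, with its natural structures, is a semisimple cocommutative involutive bialgebra. Analogously, the dual semigroup algebra of $S$, with its natural structures, is a commutative involutive bialgebra. (b) Conversely, every finite-dimensional semisimple cocommutative involutive bialgebra over $\mathbb{C}$ is isomorphic, as an involutive bialgebra, to the semigroup algebra of a finite inverse semigroup with identity element. In the dual version, every finite-dimensional semisimple commutative involutive bialgebra over $\mathbb{C}$ is isomorphic, as an involutive bialgebra, to the dual semigroup algebra of a finite inverse semigroup with identity element.
   Context: An inverse semigroup is a semigroup $S$ in which every element $a$ has a unique inverse, i.e. a unique $b\in S$ with $aba=a$ and $bab=b$; this $b$ is denoted $a^{-1}$. A bialgebra over $\mathbb{C}$ is a vector space with a structure of an associative unital algebra and of a coassociative counital coalgebra such that the comultiplication $\Delta$ and the counit are algebra homomorphisms. A coalgebra is semisimple if its dual algebra is semisimple. All bialgebras here are finite-dimensional, and ''semisimple'' means semisimple both as an algebra and as a coalgebra. An involution $\sharp$ on $A$ is an antilinear antiautomorphism of order two of the algebra $A$. A coinvolution $\flat$ on $A$ is an antilinear antiautomorphism of order two of the coalgebra $A$: $(\flat\otimes\flat)\Delta=J\Delta\flat$, where $J(x\otimes y)=y\otimes x$. An involutive bialgebra is a bialgebra equipped with an involution $\sharp$ and a coinvolution $\flat$ such that $\Delta\sharp=(\sharp\otimes\sharp)\Delta$ and $x^\flat\cdot y^\flat=(x\cdot y)^\flat$ for all $x,y$. An isomorphism of involutive bialgebras is a bialgebra isomorphism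 that intertwines the involutions and the coinvolutions. Natural structures on the semigroup algebra $\mathbb{C}(S)$ (the vector space with basis $S$, with multiplication extending that of $S$ bilinearly): $\Delta(s)=s\otimes s$, counit $s\mapsto 1$, involution $\left(\sum_s c_s s\right)^{\sharp}=\sum_s\overline{c_s}\,s^{-1}$, coinvolution $\left(\sum_s c_s s\right)^{\flat}=\sum_s\overline{c_s}\,s$. The dual semigroup algebra of $S$ is the space of complex functions on $S$ with pointwise multiplication, unit the constant function $1$, comultiplication $(\Delta f)(s,t)=f(st)$, counit $f\mapsto f(1_S)$ (where $1_S$ is the identity element of $S$), involution $f^{\sharp}(s)=\overline{f(s)}$, coinvolution $f^{\flat}(s)=\overline{f(s^{-1})}$.
   Formalization: ''Semisimple'' also requires that *-representations of (A,♯) and of its dual algebra with f*(x)=conj f(x^♭) on finite-dimensional Hilbert spaces separate points; otherwise (b) fails, e.g. for C[Z/3] with ♯ and ♭ both fixing the group elements. *)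

(* Defs.v *)
From HB Require Import structures.
From mathcomp Require Import all_boot all_order all_algebra falgebra.

Set Implicit Arguments.
Unset Strict Implicit.
Unset Printing Implicit Defensive.

Import GRing.Theory Num.Theory.

Local Open Scope ring_scope.

(** * Finite inverse semigroups with identity *)

Section InverseSemigroup.

Variables (S : finType) (e : S) (op : Monoid.law e).

Definition are_inverse (a b : S) : bool :=
  (op (op a b) a == a) && (op (op b a) b == b).

Definition inverse_semigroup : Prop := forall a : S, exists! b, are_inverse a b.

(* The default value [a] is never used when [op] is an inverse semigroup. *)
Definition sinv (a : S) : S := odflt a [pick b | are_inverse a b].

End InverseSemigroup.

(** * Tensor products of finite-dimensional spaces *)

(* [U (x) V] is modelled by the matrices of coordinates in the products
   [e_i (x) f_j] of the library's canonical bases of [U] and [V].  The lemmas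
   [tliftE] and [tens_span] are its universal property. *)

Section Tensor.

Variable K : fieldType.

Definition tens (U V : vectType K) : vectType K :=
  'M[K]_(\dim (fullv : {vspace U}), \dim (fullv : {vspace V})).

Definition tensv (U V : vectType K) (x : U) (y : V) : tens U V :=
  \matrix_(i, j) (coord (vbasis fullv) i x * coord (vbasis fullv) j y).

(* The map [U (x) V -> W] with [x (x) y |-> f x y]; the scaling [s] is [*:%R]
   if [f] is bilinear, and [Num.conj \; *:%R] if [f] is antilinear in each
   argument. *)
Definition tlift (U V W : vectType K) (s : K -> W -> W) (f : U -> V -> W)
    (t : tens U V) : W :=
  \sum_i \sum_j s ((t : 'M[K]_(_, _)) i j) (f (vbasis fullv)`_i (vbasis fullv)`_j).

Definition tflip (U V : vectType K) : tens U V -> tens V U :=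
  tlift *:%R (fun x y => tensv y x).

Definition tassoc (U V W : vectType K) :
    tens (tens U V) W -> tens U (tens V W) :=
  tlift *:%R (fun u z => tlift *:%R (fun x y => tensv x (tensv y z)) u).

(* [f (x) g], for [f] and [g] both linear. *)
Definition tmap (U V U' V' : vectType K) (f : U -> U') (g : V -> V') :
    tens U V -> tens U' V' :=
  tlift *:%R (fun x y => tensv (f x) (g y)).

Definition tmul (A B : falgType K) (u v : tens A B) : tens A B :=
  tlift *:%R
    (fun a b => tlift *:%R (fun c d => tensv (a * c) (b * d)) v) u.

Lemma tensv_linear_l (U V : vectType K) (y : V) :
  linear (fun x : U => tensv x y).
Proof.
by move=> a x x'; apply/matrixP => i j; rewrite !mxE linearP mulrDl -mulrA.
Qed.

Lemma tensv_linear_r (U V : vectType K) (x : U) :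
  linear (fun y : V => tensv x y).
Proof.
move=> a y y'; apply/matrixP => i j.
by rewrite !mxE linearP mulrDr mulrCA.
Qed.

Lemma tensv_basis (U V : vectType K) (i : 'I_(\dim (fullv : {vspace U})))
    (j : 'I_(\dim (fullv : {vspace V}))) :
  @tensv U V (vbasis fullv)`_i (vbasis fullv)`_j = delta_mx i j.
Proof.
apply/matrixP => i' j'; rewrite !mxE.
rewrite !coord_free ?(basis_free (vbasisP _)) //.
by rewrite -natrM mulnb (eq_sym i) (eq_sym j).
Qed.

Lemma tens_span (U V : vectType K) (t : tens U V) : tlift *:%R (@tensv U V) t = t.
Proof.
rewrite [RHS]matrix_sum_delta; apply: eq_bigr => i _; apply: eq_bigr => j _.
by rewrite tensv_basis.
Qed.

Lemma tlift_linear (U V W : vectType K) (f : U -> V -> W) :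
  linear (tlift *:%R f).
Proof.
move=> a u v; rewrite /tlift scaler_sumr -big_split; apply: eq_bigr => i _ /=.
rewrite scaler_sumr -big_split; apply: eq_bigr => j _ /=.
by rewrite !mxE scalerDl scalerA.
Qed.

Lemma tliftE (U V W : vectType K) (nu : {rmorphism K -> K}) (f : U -> V -> W)
    (x : U) (y : V) :
    (forall y, linear_for (nu \; *:%R) (f ^~ y)) ->
    (forall x, linear_for (nu \; *:%R) (f x)) ->
  tlift (nu \; *:%R) f (tensv x y) = f x y.
Proof.
move=> fl fr.
have f0l z : f 0 z = 0.
  by move: (fl z (-1) 0 0); rewrite scaler0 addr0 /= rmorphN1 scaleN1r addNr.
have f0r z : f z 0 = 0.
  by move: (fr z (-1) 0 0); rewrite scaler0 addr0 /= rmorphN1 scaleN1r addNr.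
have fsl n (c : 'I_n -> K) (e : 'I_n -> U) z :
    f (\sum_i c i *: e i) z = \sum_i nu (c i) *: f (e i) z.
  elim/big_rec2: _ => [|i u v _ <-]; first exact: f0l.
  by rewrite fl.
have fsr n (c : 'I_n -> K) (e : 'I_n -> V) z :
    f z (\sum_i c i *: e i) = \sum_i nu (c i) *: f z (e i).
  elim/big_rec2: _ => [|i u v _ <-]; first exact: f0r.
  by rewrite fr.
rewrite {2}(coord_vbasis (memvf x)) fsl; apply: eq_bigr => i _.
rewrite {2}(coord_vbasis (memvf y)) fsr scaler_sumr; apply: eq_bigr => j _.
by rewrite scalerA -rmorphM mxE.
Qed.

End Tensor.

(** * Semisimple algebras *)

(* These notions are stated for a product on a vector space, so that they
   apply both to an algebra and to the dual of a coalgebra. *)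

Section Semisimple.

Variables (K : fieldType) (V : vectType K) (mul : V -> V -> V).

Definition left_ideal (I : {vspace V}) : Prop :=
  forall x y, y \in I -> mul x y \in I.

Definition minimal_left_ideal (I : {vspace V}) : Prop :=
  [/\ I != 0%VS, left_ideal I
    & forall J, left_ideal J -> (J <= I)%VS -> J = 0%VS \/ J = I].

Definition semisimple_algebra : Prop :=
  exists (n : nat) (I : 'I_n -> {vspace V}),
    [/\ forall i, minimal_left_ideal (I i),
        directv (\sum_(i < n) I i) & (\sum_(i < n) I i)%VS = fullv].

End Semisimple.

Section StarAlgebra.

Variables (C : numClosedFieldType) (V : vectType C) (mul : V -> V -> V).
Variable star : V -> V.

Definition antilinear (U W : lmodType C) (f : U -> W) : Prop :=
  linear_for (Num.conj \; *:%R) f.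

Definition algebra_involution : Prop :=
  [/\ antilinear star, forall x y, star (mul x y) = mul (star y) (star x)
    & involutive star].

Definition star_representation (n : nat) (phi : V -> 'M[C]_n) : Prop :=
  [/\ linear phi, forall x y, phi (mul x y) = phi x *m phi y
    & forall x, phi (star x) = map_mx Num.conj (phi x)^T].

(* A finite-dimensional involutive algebra is called semisimple when, besides
   being semisimple as an algebra, it has enough *-representations on
   (finite-dimensional) Hilbert spaces to separate its points, i.e. when it is
   a direct sum of matrix algebras as an involutive algebra.  The second
   condition is not automatic: it fails on the group algebra of Z/3 for the
   antilinear extension of the identity of the group. *)
Definition semisimple_star_algebra : Prop :=
  semisimple_algebra mul /\
  forall x, x != 0 ->
    exists (n : nat) (phi : V -> 'M[C]_n), star_representation phi /\ phi x != 0.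

End StarAlgebra.

(** * Involutive bialgebras *)

Section Bialgebra.

Variable C : numClosedFieldType.

Record bialgebra_data (A : falgType C) := BialgebraData {
  comul : A -> tens A A;
  counit : A -> C;
  sharp : A -> A;
  flat : A -> A
}.

Section Predicates.

Variables (A : falgType C) (D : bialgebra_data A).

Let Delta := comul D.
Let eps := counit D.

Definition coalgebra : Prop :=
  [/\ linear Delta, scalar eps,
      forall x, tassoc (tmap Delta id (Delta x)) = tmap id Delta (Delta x),
      forall x, tlift *:%R (fun a b => eps a *: b) (Delta x) = x
    & forall x, tlift *:%R (fun a b => eps b *: a) (Delta x) = x].

Definition bialgebra : Prop :=
  [/\ coalgebra,
      Delta 1 = tensv 1 1, forall x y, Delta (x * y) = tmul (Delta x) (Delta y),
      eps 1 = 1 & forall x y, eps (x * y) = eps x * eps y].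

(* [f (x) f] for an antilinear [f]. *)
Definition antitmap (f : A -> A) : tens A A -> tens A A :=
  tlift (Num.conj \; *:%R) (fun x y => tensv (f x) (f y)).

Definition coalgebra_coinvolution (f : A -> A) : Prop :=
  [/\ antilinear f, forall x, antitmap f (Delta x) = tflip (Delta (f x))
    & involutive f].

Definition involutive_bialgebra : Prop :=
  [/\ bialgebra,
      algebra_involution *%R (sharp D),
      coalgebra_coinvolution (flat D),
      forall x, Delta (sharp D x) = antitmap (sharp D) (Delta x)
    & forall x y, flat D x * flat D y = flat D (x * y)].

Definition cocommutative : Prop := forall x, tflip (Delta x) = Delta x.

(* The dual of the coalgebra: [(f * g)(x) = (f (x) g)(Delta x)], with the
   involution induced by the coinvolution.  [linfun] turns a function that is
   linear (here, because [D] is a coalgebra with coinvolution) into an element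
   of ['Hom]. *)
Definition dual_mul (f g : 'Hom(A, C^o)) : 'Hom(A, C^o) :=
  linfun (fun x => tlift *:%R (fun a b => f a * g b : C^o) (Delta x)).

Definition dual_star (f : 'Hom(A, C^o)) : 'Hom(A, C^o) :=
  linfun (fun x => Num.conj (f (flat D x)) : C^o).

Definition semisimple : Prop :=
  semisimple_star_algebra *%R (sharp D) /\
  semisimple_star_algebra dual_mul dual_star.

End Predicates.

Definition involutive_bialgebra_iso (A B : falgType C)
    (D : bialgebra_data A) (E : bialgebra_data B) : Prop :=
  exists f : {lrmorphism A -> B},
    [/\ bijective f,
        forall x, comul E (f x) = tmap f f (comul D x)
      & [/\ forall x, counit E (f x) = counit D x,
        forall x, f (sharp D x) = sharp E (f x)
      & forall x, f (flat D x) = flat E (f x)]].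

End Bialgebra.

(** * The semigroup algebra and its dual *)

(* Both have the space of complex functions on [S] as carrier, with different
   products. *)

Definition semigroup_algebra (C : numClosedFieldType) (S : finType) (e : S)
  (op : Monoid.law e) : Type := {ffun S -> C^o}.

Definition dual_semigroup_algebra (C : numClosedFieldType) (S : finType) (e : S)
  (op : Monoid.law e) : Type := {ffun S -> C^o}.

Section SemigroupAlgebra.

Variables (C : numClosedFieldType) (S : finType) (e : S) (op : Monoid.law e).

Local Notation CS := (semigroup_algebra C op).

HB.instance Definition _ := Vector.copy CS {ffun S -> C^o}.

(* The basis element [s], as a function on [S]. *)
Definition sg_elt (s : S) : CS := [ffun t => (t == s)%:R].

Definition sg_mul (x y : CS) : CS :=
  \sum_(s : S) \sum_(t : S) (x s * y t : C) *: sg_elt (op s t).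

Lemma sg_eltE (x : CS) : x = \sum_(s : S) (x s : C) *: sg_elt s.
Proof.
apply/ffunP => t; rewrite sum_ffunE (bigD1 t) //= big1 => [|s st].
  by rewrite addr0 !ffunE eqxx [RHS]mulr1.
by rewrite !ffunE eq_sym (negPf st) [LHS]mulr0.
Qed.

Fact sg_mul_linear_l y : linear (sg_mul ^~ y).
Proof.
move=> a x x'; rewrite /sg_mul scaler_sumr -big_split; apply: eq_bigr => s _ /=.
rewrite scaler_sumr -big_split; apply: eq_bigr => t _ /=.
by rewrite !ffunE mulrDl scalerDl scalerA mulrA.
Qed.

Fact sg_mul_linear_r y : linear (sg_mul y).
Proof.
move=> a x x'; rewrite /sg_mul scaler_sumr -big_split; apply: eq_bigr => s _ /=.
rewrite scaler_sumr -big_split; apply: eq_bigr => t _ /=.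
by rewrite !ffunE mulrDr scalerDl scalerA mulrCA.
Qed.

Fact sg_mul_suml (I : finType) (c : I -> C) (x : I -> CS) y :
  sg_mul (\sum_i c i *: x i) y = \sum_i c i *: sg_mul (x i) y.
Proof.
elim/big_rec2: _ => [|i u v _ <-]; last exact: sg_mul_linear_l.
by have := sg_mul_linear_l y (-1) 0 0; rewrite scaler0 addr0 scaleN1r addNr.
Qed.

Fact sg_mul_sumr (I : finType) (c : I -> C) (y : I -> CS) x :
  sg_mul x (\sum_i c i *: y i) = \sum_i c i *: sg_mul x (y i).
Proof.
elim/big_rec2: _ => [|i u v _ <-]; last exact: sg_mul_linear_r.
by have := sg_mul_linear_r x (-1) 0 0; rewrite scaler0 addr0 scaleN1r addNr.
Qed.

Lemma sg_mul_elt s t : sg_mul (sg_elt s) (sg_elt t) = sg_elt (op s t).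
Proof.
rewrite /sg_mul (bigD1 s) //= [X in _ + X]big1 => [|s' ss'].
  rewrite (bigD1 t) //= big1 => [|t' tt'].
    by rewrite !addr0 !ffunE !eqxx mulr1 scale1r.
  by rewrite !ffunE (negPf tt') mulr0 scale0r.
by rewrite big1 // => t' _; rewrite !ffunE (negPf ss') mul0r scale0r.
Qed.

Fact sg_mulA : associative sg_mul.
Proof.
move=> x y z; rewrite (sg_eltE x) !sg_mul_suml; apply: eq_bigr => s _.
congr (_ *: _); rewrite (sg_eltE y) sg_mul_suml !sg_mul_sumr sg_mul_suml.
apply: eq_bigr => t _; congr (_ *: _).
rewrite sg_mul_elt (sg_eltE z) !sg_mul_sumr; apply: eq_bigr => u _.
by rewrite !sg_mul_elt Monoid.mulmA.
Qed.

Fact sg_mul1x : left_id (sg_elt e) sg_mul.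
Proof.
move=> x; rewrite {2}(sg_eltE x) {1}(sg_eltE x) sg_mul_sumr.
by apply: eq_bigr => s _; rewrite sg_mul_elt Monoid.mul1m.
Qed.

Fact sg_mulx1 : right_id (sg_elt e) sg_mul.
Proof.
move=> x; rewrite {2}(sg_eltE x) {1}(sg_eltE x) sg_mul_suml.
by apply: eq_bigr => s _; rewrite sg_mul_elt Monoid.mulm1.
Qed.

Fact sg_mulDl : left_distributive sg_mul +%R.
Proof. by move=> x y z; have := sg_mul_linear_l z 1 x y; rewrite !scale1r. Qed.

Fact sg_mulDr : right_distributive sg_mul +%R.
Proof. by move=> x y z; have := sg_mul_linear_r x 1 y z; rewrite !scale1r. Qed.

Fact sg_1_neq0 : sg_elt e != 0.
Proof.
by apply/eqP => /ffunP/(_ e); rewrite !ffunE eqxx => /eqP; rewrite oner_eq0.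
Qed.

HB.instance Definition _ := GRing.Zmodule_isNzRing.Build CS
  sg_mulA sg_mul1x sg_mulx1 sg_mulDl sg_mulDr sg_1_neq0.

Fact sg_scaleAl (a : C) (x y : CS) : a *: (x * y) = a *: x * y.
Proof.
by have := sg_mul_linear_l y a x 0; rewrite addr0 (mul0r y : sg_mul 0 y = 0) addr0 => <-.
Qed.
HB.instance Definition _ := GRing.Lmodule_isLalgebra.Build C CS sg_scaleAl.

Fact sg_scaleAr (a : C) (x y : CS) : a *: (x * y) = x * (a *: y).
Proof.
by have := sg_mul_linear_r x a y 0; rewrite addr0 (mulr0 x : sg_mul x 0 = 0) addr0 => <-.
Qed.
HB.instance Definition _ := GRing.Lalgebra_isAlgebra.Build C CS sg_scaleAr.

HB.instance Definition _ := Algebra_isFalgebra.Build C CS.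

Definition sg_data : bialgebra_data CS := {|
  comul := fun x : CS => \sum_(s : S) (x s : C) *: tensv (sg_elt s) (sg_elt s);
  counit := fun x : CS => \sum_(s : S) (x s : C);
  sharp := fun x : CS => \sum_(s : S) (Num.conj (x s : C)) *: sg_elt (sinv op s);
  flat := fun x : CS => \sum_(s : S) (Num.conj (x s : C)) *: sg_elt s
|}.

End SemigroupAlgebra.

Section DualSemigroupAlgebra.

Variables (C : numClosedFieldType) (S : finType) (e : S) (op : Monoid.law e).

Local Notation FS := (dual_semigroup_algebra C op).

(* Pointwise operations. *)
HB.instance Definition _ := Vector.copy FS {ffun S -> C^o}.
HB.instance Definition _ := GRing.Zmodule_isNzRing.Build FS
  (@ffun_mulA _ _) (@ffun_mul_1l _ _) (@ffun_mul_1r _ _)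
  (@ffun_mul_addl _ _) (@ffun_mul_addr _ _) (ffun1_nonzero C^o e).

Fact dsg_scaleAl (a : C) (f g : FS) : a *: (f * g) = a *: f * g.
Proof. by apply/ffunP => s; rewrite !ffunE scalerAl. Qed.
HB.instance Definition _ := GRing.Lmodule_isLalgebra.Build C FS dsg_scaleAl.

Fact dsg_scaleAr (a : C) (f g : FS) : a *: (f * g) = f * (a *: g).
Proof. by apply/ffunP => s; rewrite !ffunE scalerAr. Qed.
HB.instance Definition _ := GRing.Lalgebra_isAlgebra.Build C FS dsg_scaleAr.

HB.instance Definition _ := Algebra_isFalgebra.Build C FS.

Definition dsg_delta (s : S) : FS := [ffun t => (t == s)%:R].

(* The function on [S * S] attached to an element of [FS (x) FS]. *)
Definition dsg_fun2 (u : tens FS FS) (s t : S) : C :=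
  tlift *:%R (fun f g : FS => f s * g t : C^o) u.

(* The element of [FS (x) FS] whose function is [(s, t) |-> f (op s t)], see
   [dsg_comulE]. *)
Definition dsg_comul (f : FS) : tens FS FS :=
  \sum_(s : S) \sum_(t : S) (f (op s t) : C) *: tensv (dsg_delta s) (dsg_delta t).

Lemma dsg_comulE (f : FS) (s t : S) : dsg_fun2 (dsg_comul f) s t = f (op s t).
Proof.
have sumE (I : finType) (c : I -> C) (u : I -> tens FS FS) :
    dsg_fun2 (\sum_i c i *: u i) s t = \sum_i c i * dsg_fun2 (u i) s t.
  have lin a v w :
      dsg_fun2 (a *: v + w) s t = a * dsg_fun2 v s t + dsg_fun2 w s t.
    exact: (@tlift_linear C FS FS C^o).
  elim/big_rec2: _ => [|i v w _ <-]; last exact: lin.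
  by have := lin (-1) 0 0; rewrite scaler0 addr0 mulN1r addNr.
have deltaE s' t' :
    dsg_fun2 (tensv (dsg_delta s') (dsg_delta t')) s t
      = (s == s')%:R * (t == t')%:R.
  rewrite /dsg_fun2.
  rewrite (@tliftE C FS FS C^o idfun (fun f g : FS => f s * g t : C^o)) ?ffunE //.
    by move=> g a x y /=; rewrite !ffunE mulrDl -mulrA.
  by move=> g a x y /=; rewrite !ffunE mulrDr mulrCA.
rewrite (_ : dsg_comul f = \sum_(s' : S)
    1 *: \sum_(t' : S) (f (op s' t') : C) *: tensv (dsg_delta s') (dsg_delta t')).
  rewrite sumE (bigD1 s) //= [X in _ + X]big1 => [|s' ss'].
    rewrite addr0 mul1r sumE (bigD1 t) //= [X in _ + X]big1 => [|t' tt'].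
      by rewrite addr0 deltaE !eqxx !mulr1.
    by rewrite deltaE [t == _]eq_sym (negPf tt') !mulr0.
  rewrite mul1r sumE big1 // => t' _.
  by rewrite deltaE [s == _]eq_sym (negPf ss') mul0r mulr0.
by apply: eq_bigr => s' _; rewrite scale1r.
Qed.

Definition dsg_data : bialgebra_data FS := {|
  comul := dsg_comul;
  counit := fun f : FS => f e : C;
  sharp := fun f : FS => [ffun s => Num.conj (f s : C)];
  flat := fun f : FS => [ffun s => Num.conj (f (sinv op s) : C)]
|}.

End DualSemigroupAlgebra.

(* Main.v *)
(* A commutative algebra with enough star-representations is reduced, and its
   multiplication operators are simultaneously diagonalizable; their common
   eigenvectors, once normalized, are orthogonal self-adjoint idempotents.
   Applied to the dual of a cocommutative bialgebra A, this gives a basis of A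
   consisting of the grouplike elements; applied to a commutative bialgebra A,
   it gives a basis of the dual of A consisting of the characters of A.  In both
   cases this basis is a finite monoid, stable under a star-operation and embedded
   in a star-algebra with enough representations by matrices.  If N is the
   matrix of an element of this monoid, two powers of N N* coincide, so the
   eigenvalues of N N* are 0 and 1 and N is a partial isometry: thus s s* s = s.
   Likewise idempotents are self-adjoint, hence commute, so that the monoid is an
   inverse semigroup with inverse s*.
   In the other direction, semisimplicity of the semigroup algebra follows from
   the faithfulness of the left regular representation by partial isometries,
   orthogonal complements of left ideals being left ideals. *)

Require Import Defs.
From HB Require Import structures.
From mathcomp Require Import all_boot all_order all_algebra falgebra.
From mathcomp Require Import boolp reals complex.

Set Implicit Arguments.
Unset Strict Implicit.
Unset Printing Implicit Defensive.

Import Order.TTheory GRing.Theory Num.Theory.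

Local Open Scope ring_scope.

Local Notation "A ^H" := (map_mx Num.conj A^T)
  (at level 8, format "A ^H") : ring_scope.

(** * Partial isometries *)

Section AdjointMatrix.

Variable C : numClosedFieldType.

Lemma adjmxK m n (A : 'M[C]_(m, n)) : A^H^H = A.
Proof. by apply/matrixP=> i j; rewrite !mxE conjCK. Qed.

Lemma adjmxM m n p (A : 'M[C]_(m, n)) (B : 'M[C]_(n, p)) : (A *m B)^H = B^H *m A^H.
Proof. by rewrite trmx_mul map_mxM. Qed.

Lemma adjmxB m n (A B : 'M[C]_(m, n)) : (A - B)^H = A^H - B^H.
Proof. by apply/matrixP=> i j; rewrite !mxE rmorphB. Qed.

Lemma adjmx1 n : (1%:M : 'M[C]_n)^H = 1%:M.
Proof. by rewrite trmx1 map_mx1. Qed.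

Lemma mxtrace_adj_mulE m n (A : 'M[C]_(m, n)) :
  \tr (A^H *m A) = \sum_i \sum_j `|A j i| ^+ 2.
Proof.
apply: eq_bigr => i _; rewrite mxE; apply: eq_bigr => j _.
by rewrite !mxE normCK mulrC.
Qed.

Lemma mxtrace_adj_mul_ge0 m n (A : 'M[C]_(m, n)) : 0 <= \tr (A^H *m A).
Proof.
by rewrite mxtrace_adj_mulE; do 2!apply: sumr_ge0 => ? _; rewrite exprn_ge0.
Qed.

Lemma mxtrace_adj_mul_eq0 m n (A : 'M[C]_(m, n)) : \tr (A^H *m A) = 0 -> A = 0.
Proof.
rewrite mxtrace_adj_mulE => /eqP; rewrite psumr_eq0 => [/allP A0|i _]; last first.
  by apply: sumr_ge0 => ? _; rewrite exprn_ge0.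
apply/matrixP=> i j; rewrite mxE; move: (A0 j (mem_index_enum _)) => /=.
rewrite psumr_eq0 => [/allP/(_ i (mem_index_enum _))/=|? _]; last by rewrite exprn_ge0.
by rewrite expf_eq0 normr_eq0 => /eqP.
Qed.

Lemma adj_mul_eq0 m n (A : 'M[C]_(m, n)) : A^H *m A = 0 -> A = 0.
Proof. by move=> A0; apply: mxtrace_adj_mul_eq0; rewrite A0 mxtrace0. Qed.

Fixpoint powmx n (A : 'M[C]_n) k : 'M[C]_n :=
  if k is k'.+1 then A *m powmx A k' else 1%:M.

Lemma powmxD n (A : 'M[C]_n) j k : powmx A (j + k) = powmx A j *m powmx A k.
Proof. by elim: j => [|j IHj]; rewrite ?mul1mx // addSn /= IHj mulmxA. Qed.

Lemma powmxSr n (A : 'M[C]_n) k : powmx A k.+1 = powmx A k *m A.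
Proof. by rewrite -addn1 powmxD /= mulmx1. Qed.

Lemma powmx_herm n (A : 'M[C]_n) k : A^H = A -> (powmx A k)^H = powmx A k.
Proof.
move=> AH; elim: k => [|k IHk]; first exact: adjmx1.
by rewrite powmxSr adjmxM IHk AH -powmxSr.
Qed.

(** One exponent is removed at a time: as [H] is self-adjoint, the Gram matrix of
    [powmx H k.+1 *m X] contains the factor [powmx H k.+2 *m X]. *)
Lemma herm_pow_mul_eq0 n m (H : 'M[C]_n) (X : 'M[C]_(n, m)) k :
  H^H = H -> powmx H k.+1 *m X = 0 -> H *m X = 0.
Proof.
move=> HH; elim: k => [|k IHk]; first by rewrite /= mulmx1.
move=> E; apply: IHk; apply: adj_mul_eq0.
rewrite adjmxM powmx_herm // -mulmxA (mulmxA (powmx H k.+1)) -powmxD addSnnS.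
by rewrite powmxD -mulmxA E !mulmx0.
Qed.

(* [N *m N^H] is positive, so a coincidence among its powers forces its
   eigenvalues to be 0 or 1. *)
Lemma pow_eq_partial_isometry n (N : 'M[C]_n) j k :
  (j < k)%N -> powmx (N *m N^H) j = powmx (N *m N^H) k -> N *m N^H *m N = N.
Proof.
have [H defH] : {H | H = N *m N^H} by exists (N *m N^H).
rewrite -defH => jk Ejk.
have HH : H^H = H by rewrite defH adjmxM adjmxK.
have HE : powmx H (k - j) *m H = H.
  apply/eqP; rewrite -subr_eq0; apply/eqP.
  have -> : powmx H (k - j) *m H - H = H *m (powmx H (k - j) - 1%:M).
    by rewrite mulmxBr mulmx1 -powmxSr.
  apply: (@herm_pow_mul_eq0 _ _ H _ j) => //=.
  by rewrite mulmxBr mulmx1 -mulmxA -powmxD subnKC ?(ltnW jk) // Ejk subrr.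
have [m Em] : exists m, (k - j = m.+1)%N by exists (k - j).-1; rewrite prednK ?subn_gt0.
(* By the geometric sum, [Y *m Q] telescopes to [H - powmx H m.+2], which vanishes by [HE]. *)
pose Q := \sum_(i < m.+1) powmx H i.
have [Y defY] : {Y | Y = H - H *m H} by exists (H - H *m H).
have YH : Y^H = Y by rewrite defY adjmxB adjmxM HH.
have YQ : Y *m Q = 0.
  have -> : Y *m Q = H *m (Q - H *m Q) by rewrite mulmxBr mulmxA defY mulmxBl.
  have -> : Q - H *m Q = 1%:M - powmx H m.+1.
    rewrite /Q mulmx_sumr -sumrB.
    under eq_bigr => i _ do rewrite -[H *m _]/(powmx H i.+1).
    elim: (m.+1) => [|r IHr]; first by rewrite big_ord0 subrr.
    by rewrite big_ord_recr /= IHr addrA subrK.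
  by rewrite mulmxBr mulmx1 -[H *m powmx H _]/(powmx H m.+2) powmxSr -Em HE subrr.
(* In [\tr (Y *m Q *m Y) = 0], exponent 0 contributes the squared norm of [Y] and all other
   exponents contribute nonnegative terms. *)
have Y0 : Y = 0.
  apply: mxtrace_adj_mul_eq0; apply/eqP; rewrite eq_le mxtrace_adj_mul_ge0 andbT.
  have : \tr (Y *m Q *m Y) = 0 by rewrite YQ mul0mx mxtrace0.
  rewrite /Q big_ord_recl /= mulmxDr mulmxDl mulmx1 mxtraceD YH => /eqP.
  rewrite addr_eq0 => /eqP->; rewrite oppr_le0 mulmx_sumr mulmx_suml raddf_sum /=.
  apply: sumr_ge0 => i _; rewrite add0n -[H *m powmx H i]/(powmx H i.+1).
  (* An even power splits as [H^r H^r] and an odd one as [H^r N N^H H^r], so that sandwiching it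
     between two copies of [Y] yields a Gram matrix. *)
  have [r [Er|Er]] : exists r, i.+1 = (r + r)%N \/ i.+1 = (r + r).+1%N.
    exists (i.+1)./2; rewrite addnn; case: (boolP (odd i.+1)) => o; [right|left].
      by rewrite -[LHS]odd_double_half o.
    by rewrite -[LHS]odd_double_half (negPf o).
  - rewrite Er powmxD.
    have -> : Y *m (powmx H r *m powmx H r) *m Y = (powmx H r *m Y)^H *m (powmx H r *m Y).
      by rewrite adjmxM powmx_herm // YH !mulmxA.
    exact: mxtrace_adj_mul_ge0.
  rewrite Er -addSn powmxD powmxSr.
  have -> : Y *m (powmx H r *m H *m powmx H r) *m Y
      = (N^H *m powmx H r *m Y)^H *m (N^H *m powmx H r *m Y).
    by rewrite !adjmxM adjmxK powmx_herm // YH {2}defH !mulmxA.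
  exact: mxtrace_adj_mul_ge0.
have HHH : H *m H = H by apply/esym/eqP; rewrite -subr_eq0 -defY Y0.
(* Now that [H] is idempotent, [Z *m Z^H] expands to [H - H - H + H] for [Z = H *m N - N]. *)
apply/eqP; rewrite -subr_eq0; apply/eqP.
rewrite -[LHS]adjmxK; set Z := _ - N; suff -> : Z^H = 0 by rewrite trmx0 map_mx0.
apply: adj_mul_eq0; rewrite adjmxK /Z adjmxB adjmxM HH mulmxBl !mulmxBr.
rewrite -/H -!mulmxA !(mulmxA N N^H) -defH !HHH.
by rewrite !subrr.
Qed.

(* An idempotent which is a partial isometry is a self-adjoint projection. *)
Lemma idem_partial_isometry_herm n (E : 'M[C]_n) :
  E *m E = E -> E *m E^H *m E = E -> E^H = E.
Proof.
move=> EE EHE.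
have EEH : E^H *m E^H = E^H by rewrite -adjmxM EE.
suff E1 : E = E^H *m E by rewrite E1 adjmxM adjmxK.
apply/eqP; rewrite -subr_eq0; apply/eqP; apply: adj_mul_eq0.
rewrite adjmxB adjmxM adjmxK mulmxBl !mulmxBr !mulmxA EEH.
by rewrite -!(mulmxA E^H E E) EE -(mulmxA _ E^H E) -(mulmxA E^H E)
  (mulmxA E E^H E) EHE !subrr.
Qed.

End AdjointMatrix.

(** * Inverse semigroups *)

Section InverseSemigroupTheory.

Variables (S : finType) (e : S) (op : Monoid.law e).

Local Notation "x ∙ y" := (op x y) (at level 40, left associativity).

Let opA x y z : x ∙ (y ∙ z) = x ∙ y ∙ z.
Proof. exact: Monoid.mulmA. Qed.

Let op1m x : e ∙ x = x.
Proof. exact: Monoid.mul1m. Qed.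

Lemma are_inverseP a b : reflect (a ∙ b ∙ a = a /\ b ∙ a ∙ b = b) (are_inverse op a b).
Proof. by apply: (iffP andP) => -[/eqP-> /eqP->]. Qed.

Lemma are_inverseC a b : are_inverse op a b -> are_inverse op b a.
Proof. by case/andP=> ab ba; apply/andP. Qed.

(** The products [ba], [ca], [ab], [ac] are idempotent; commuting them brings both [b] and [c] to
    the form [bac]. *)
Lemma are_inverse_unique a b c :
    (forall x y, x ∙ x = x -> y ∙ y = y -> x ∙ y = y ∙ x) ->
  are_inverse op a b -> are_inverse op a c -> b = c.
Proof.
move=> idC /are_inverseP[aba bab] /are_inverseP[aca cac].
have C1 : b ∙ a ∙ (c ∙ a) = c ∙ a ∙ (b ∙ a).
  by apply: idC; rewrite opA ?bab ?cac.
have C2 : a ∙ b ∙ (a ∙ c) = a ∙ c ∙ (a ∙ b).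
  by apply: idC; rewrite opA ?aba ?aca.
transitivity (b ∙ a ∙ c).
  rewrite -[LHS]bab -{1}aca -!opA (opA a c) -C2.
  by rewrite !opA bab.
rewrite -[RHS]cac -{2}aba !opA -(opA (c ∙ a)) -C1.
by rewrite -!opA (opA c a c) cac.
Qed.

(** For idempotents [f] and [h], regularity of [fh] reads [fh hf fh = fh], so [fh] is idempotent,
    hence fixed by [inv], and [fh = hf]. Commuting idempotents then give uniqueness of inverses. *)
Lemma regular_star_inverse_semigroup (inv : S -> S) :
    (forall s, s ∙ inv s ∙ s = s) -> involutive inv ->
    (forall s t, inv (s ∙ t) = inv t ∙ inv s) ->
    (forall f, f ∙ f = f -> inv f = f) ->
  inverse_semigroup op /\ sinv op =1 inv.
Proof.
move=> reg invK invM invI.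
have idM f h : f ∙ f = f -> h ∙ h = h -> (f ∙ h) ∙ (f ∙ h) = f ∙ h.
  move=> ff hh; have := reg (f ∙ h); rewrite invM !invI //.
  by rewrite !opA -(opA f h h) hh -(opA _ f f) ff.
have idC f h : f ∙ f = f -> h ∙ h = h -> f ∙ h = h ∙ f.
  by move=> ff hh; rewrite -(invI _ (idM _ _ ff hh)) invM !invI.
have iP s : are_inverse op s (inv s).
  by apply/are_inverseP; split=> //; have := reg (inv s); rewrite invK.
split=> [s|s]; first by exists (inv s); split=> // t; apply: are_inverse_unique.
rewrite /sinv; case: pickP => [t st|/(_ (inv s))]; last by rewrite iP.
exact: are_inverse_unique st (iP s).
Qed.

Hypothesis invS : inverse_semigroup op.

Local Notation inv := (sinv op).

Lemma sinvP s : are_inverse op s (inv s).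
Proof.
rewrite /sinv; case: pickP => //= no; have [b [sb _]] := invS s.
by rewrite no in sb.
Qed.

Lemma sinv_unique a b : are_inverse op a b -> inv a = b.
Proof.
by move=> ab; have [c [_ cU]] := invS a; rewrite -(cU _ ab) -(cU _ (sinvP a)).
Qed.

Lemma mulsVs s : s ∙ inv s ∙ s = s.
Proof. by case/are_inverseP: (sinvP s). Qed.

Lemma mulVsV s : inv s ∙ s ∙ inv s = inv s.
Proof. by case/are_inverseP: (sinvP s). Qed.

Lemma sinvK : involutive inv.
Proof. by move=> s; apply/sinv_unique/are_inverseC/sinvP. Qed.

Lemma sinv_idem f : f ∙ f = f -> inv f = f.
Proof. by move=> ff; apply/sinv_unique/are_inverseP; rewrite !ff. Qed.

(* With [x] the inverse of [fh], the idempotent [h x f] is also inverse to [fh]. *)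
Lemma idem_mul f h : f ∙ f = f -> h ∙ h = h -> (f ∙ h) ∙ (f ∙ h) = f ∙ h.
Proof.
move=> ff hh; pose x := inv (f ∙ h).
have xP := mulVsV (f ∙ h); have fP := mulsVs (f ∙ h); rewrite -/x in xP fP.
have yy : (h ∙ x ∙ f) ∙ (h ∙ x ∙ f) = h ∙ x ∙ f.
  by rewrite -{3}xP !opA.
have fhy : are_inverse op (h ∙ x ∙ f) (f ∙ h).
  apply/are_inverseP; split.
    rewrite -{3}xP !opA -(opA _ f f) ff.
    by rewrite -(opA _ h h) hh.
  rewrite -{3}fP !opA -(opA f h h) hh.
  by rewrite -(opA _ f f) ff.
by rewrite -(sinv_unique fhy) (sinv_idem yy).
Qed.

(** Being idempotent, [fh] is its own inverse; [hf] is an inverse of it too, and inverses are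
    unique. *)
Lemma idem_commute f h : f ∙ f = f -> h ∙ h = h -> f ∙ h = h ∙ f.
Proof.
move=> ff hh; rewrite -(sinv_idem (idem_mul ff hh)); apply/sinv_unique/are_inverseP.
have fhfh := idem_mul ff hh; have hfhf := idem_mul hh ff.
rewrite !opA in fhfh hfhf *; split.
  by rewrite -(opA f h h) hh -(opA _ f f) ff.
by rewrite -(opA h f f) ff -(opA _ h h) hh.
Qed.

Lemma mulsV_idem s : (s ∙ inv s) ∙ (s ∙ inv s) = s ∙ inv s.
Proof. by rewrite opA mulsVs. Qed.

Lemma mulVs_idem s : (inv s ∙ s) ∙ (inv s ∙ s) = inv s ∙ s.
Proof. by rewrite opA mulVsV. Qed.

(** The idempotents [t t^-1] and [s^-1 s] that meet in the middle of the products commute, after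
    which each factor absorbs its own inverse. *)
Lemma sinvM s t : inv (s ∙ t) = inv t ∙ inv s.
Proof.
apply/sinv_unique/are_inverseP.
have E := idem_commute (mulsV_idem t) (mulVs_idem s).
split.
  have -> : s ∙ t ∙ (inv t ∙ inv s) ∙ (s ∙ t) = s ∙ ((t ∙ inv t) ∙ (inv s ∙ s)) ∙ t.
    by rewrite !opA.
  by rewrite E !opA mulsVs -(opA s t) -(opA s _ t) mulsVs.
have -> : inv t ∙ inv s ∙ (s ∙ t) ∙ (inv t ∙ inv s)
    = inv t ∙ ((inv s ∙ s) ∙ (t ∙ inv t)) ∙ inv s by rewrite !opA.
by rewrite -E !opA mulVsV -(opA (inv t)) -(opA (inv t)) mulVsV.
Qed.

End InverseSemigroupTheory.

(** * Finite star-monoids inside an algebra with separating star-representations *)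

Section StarSemigroup.

Variables (C : numClosedFieldType) (V : vectType C) (mul : V -> V -> V).
Variable star : V -> V.
Hypothesis sepV : forall x, x != 0 ->
  exists (n : nat) (phi : V -> 'M[C]_n), star_representation mul star phi /\ phi x != 0.

Lemma star_rep0 n (phi : V -> 'M[C]_n) : star_representation mul star phi -> phi 0 = 0.
Proof. by case=> /(_ (-1) 0 0) + _ _; rewrite scaler0 addr0 scaleN1r addNr. Qed.

Lemma star_rep_sepP x y :
    (forall n (phi : V -> 'M[C]_n), star_representation mul star phi -> phi x = phi y) ->
  x = y.
Proof.
move=> E; apply/eqP; rewrite -subr_eq0; apply: contraT => /sepV[n [phi [phiP]]].
have [lin _ _] := phiP; rewrite addrC -scaleN1r lin (E _ _ phiP) scaleN1r addNr.
by rewrite eqxx.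
Qed.

Variables (S : finType) (e : S) (op : Monoid.law e) (g : S -> V) (inv : S -> S).
Hypothesis g_inj : injective g.
Hypothesis gM : forall s t, g (op s t) = mul (g s) (g t).
Hypothesis gV : forall s, g (inv s) = star (g s).

Lemma star_inverse_semigroup : inverse_semigroup op /\ sinv op =1 inv.
Proof.
have sep s t : (forall n (phi : V -> 'M[C]_n), star_representation mul star phi ->
    phi (g s) = phi (g t)) -> s = t.
  by move=> E; apply/g_inj/star_rep_sepP.
have phiV n (phi : V -> 'M[C]_n) s : star_representation mul star phi ->
    phi (g (inv s)) = (phi (g s))^H by case=> _ _ phiS; rewrite gV phiS.
have phiM n (phi : V -> 'M[C]_n) s t : star_representation mul star phi ->
    phi (g (op s t)) = phi (g s) *m phi (g t) by case=> _ phiM _; rewrite gM phiM.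
have reg n (phi : V -> 'M[C]_n) s : star_representation mul star phi ->
    phi (g s) *m (phi (g s))^H *m phi (g s) = phi (g s).
  move=> phiP; pose h := op s (inv s).
  pose p k := iter k (op h) e.
  have phie : phi (g e) *m phi (g s) = phi (g s) by rewrite -phiM // Monoid.mul1m.
  (* The representation may fail to be unital, so powers in [S] are compared with matrix powers from
     exponent 1 on. *)
  have phip k : phi (g (p k.+1)) = powmx (phi (g s) *m (phi (g s))^H) k.+1.
    elim: k => [|k IHk].
      by rewrite /p /= Monoid.mulm1 phiM // phiV // mulmx1.
    by rewrite [p _]/(op h (p k.+1)) phiM // IHk phiM // phiV.
  (* Pigeonhole: among [#|S|.+1] successive powers of [h] two are equal. *)
  have /injectivePn[i [j ij Eij]] : ~~ injectiveb (fun i : 'I_#|S|.+1 => p i.+1).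
    by apply/injectiveP => /leq_card; rewrite card_ord ltnn.
  have {}Eij : powmx (phi (g s) *m (phi (g s))^H) i.+1
       = powmx (phi (g s) *m (phi (g s))^H) j.+1 by rewrite -!phip Eij.
  case: (ltngtP i j) => [lt_ij|lt_ji|/val_inj/eqP]; last by rewrite (negPf ij).
    exact: (@pow_eq_partial_isometry _ _ _ i.+1 j.+1).
  exact: (@pow_eq_partial_isometry _ _ _ j.+1 i.+1).
apply: regular_star_inverse_semigroup.
- by move=> s; apply: sep => n phi phiP; rewrite !phiM // phiV // reg.
- by move=> s; apply: sep => n phi phiP; rewrite !phiV // adjmxK.
- by move=> s t; apply: sep => n phi phiP; rewrite !(phiM, phiV) // adjmxM.
move=> f ff; apply: sep => n phi phiP; rewrite phiV //.
by apply: idem_partial_isometry_herm; [rewrite -phiM // ff|exact: reg].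
Qed.

End StarSemigroup.

(** * Semilinear maps and tensors *)

Section SemilinearMaps.

Variables (K : fieldType) (nu : {rmorphism K -> K}).

Lemma semilin0 (U W : lmodType K) (F : U -> W) :
  linear_for (nu \; *:%R) F -> F 0 = 0.
Proof. by move/(_ (-1) 0 0); rewrite scaler0 addr0 /= rmorphN1 scaleN1r addNr. Qed.

Lemma semilin_sum (U W : lmodType K) (F : U -> W) (I : finType) (c : I -> K)
    (u : I -> U) :
    linear_for (nu \; *:%R) F ->
  F (\sum_i c i *: u i) = \sum_i nu (c i) *: F (u i).
Proof.
move=> lF; elim/big_rec2: _ => [|i v w _ <-]; first exact: semilin0 lF.
exact: lF.
Qed.

Lemma tlift_semilin (U V W : vectType K) (f : U -> V -> W) :
  linear_for (nu \; *:%R) (tlift (nu \; *:%R) f).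
Proof.
move=> a u v; rewrite /tlift /= scaler_sumr -big_split; apply: eq_bigr => i _ /=.
rewrite scaler_sumr -big_split; apply: eq_bigr => j _ /=.
by rewrite !mxE rmorphD rmorphM scalerDl scalerA.
Qed.

(** Pure tensors span. The parameter [nu] lets one proof serve linear maps ([idfun]) and antilinear
    maps ([Num.conj]). *)
Lemma semilin_tens_ext (U V : vectType K) (W : lmodType K) (F G : tens U V -> W) :
    linear_for (nu \; *:%R) F -> linear_for (nu \; *:%R) G ->
    (forall x y, F (tensv x y) = G (tensv x y)) ->
  F =1 G.
Proof.
move=> lF lG E t; rewrite -(tens_span t) /tlift.
have sumE H : linear_for (nu \; *:%R) H ->
    H (\sum_i \sum_j t i j *: @tensv K U V (vbasis fullv)`_i (vbasis fullv)`_j) =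
    \sum_i \sum_j nu (t i j) *: H (tensv (vbasis fullv)`_i (vbasis fullv)`_j) :> W.
  move=> lH; under eq_bigr => i _ do rewrite -[\sum_j _]scale1r.
  rewrite semilin_sum //; apply: eq_bigr => i _.
  by rewrite rmorph1 scale1r semilin_sum.
by rewrite !sumE //; apply: eq_bigr => i _; apply: eq_bigr => j _; rewrite E.
Qed.

End SemilinearMaps.

Section LinearMaps.

Variable K : fieldType.

Lemma lin0 (U W : lmodType K) (F : U -> W) : linear F -> F 0 = 0.
Proof. exact: (@semilin0 K idfun). Qed.

Lemma lin_sum (U W : lmodType K) (F : U -> W) (I : finType) (c : I -> K)
    (u : I -> U) :
  linear F -> F (\sum_i c i *: u i) = \sum_i c i *: F (u i).
Proof. exact: (@semilin_sum K idfun). Qed.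

Lemma linZ (U W : lmodType K) (F : U -> W) a x : linear F -> F (a *: x) = a *: F x.
Proof. by move=> lF; have := lF a x 0; rewrite !addr0 (lin0 lF) addr0. Qed.

Lemma lin_id (U : lmodType K) : linear (@id U).
Proof. by []. Qed.

Lemma lin_comp (U V W : lmodType K) (F : U -> V) (G : V -> W) :
  linear F -> linear G -> linear (fun x => G (F x)).
Proof. by move=> lF lG a x y; rewrite lF lG. Qed.

Lemma lin_sumf (U W : lmodType K) (I : finType) (F : I -> U -> W) :
  (forall i, linear (F i)) -> linear (fun x => \sum_i F i x).
Proof.
move=> lF a x y; rewrite scaler_sumr -big_split; apply: eq_bigr => i _.
by rewrite lF.
Qed.

Lemma lin_scalef (U W : lmodType K) (f : U -> K^o) (w : W) :
  linear f -> linear (fun x => (f x : K) *: w).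
Proof. by move=> lf a x y; rewrite lf scalerDl scalerA. Qed.

Lemma comp_semilin (nu : K -> K) (U V W : lmodType K) (F : U -> V) (G : V -> W) :
  linear F -> linear_for (nu \; *:%R) G -> linear_for (nu \; *:%R) (fun x => G (F x)).
Proof. by move=> lF lG a x y; rewrite lF lG. Qed.

Lemma semilin_comp (nu : K -> K) (U V W : lmodType K) (F : U -> V) (G : V -> W) :
  linear_for (nu \; *:%R) F -> linear G -> linear_for (nu \; *:%R) (fun x => G (F x)).
Proof. by move=> lF lG a x y; rewrite lF lG. Qed.

Lemma lin_tens_ext (U V : vectType K) (W : lmodType K) (F G : tens U V -> W) :
    linear F -> linear G -> (forall x y, F (tensv x y) = G (tensv x y)) ->
  F =1 G.
Proof. exact: (@semilin_tens_ext K idfun). Qed.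

Lemma tliftE_lin (U V W : vectType K) (f : U -> V -> W) x y :
    (forall y, linear (f ^~ y)) -> (forall x, linear (f x)) ->
  tlift *:%R f (tensv x y) = f x y.
Proof. exact: (@tliftE K U V W idfun). Qed.

(** Meant for nested uses of [tlift], as in [tassoc] and [tmul], where the inner bilinear map
    depends linearly on an outer variable. *)
Lemma tlift_linear_param (P : lmodType K) (U V W : vectType K) (f : P -> U -> V -> W) u :
    (forall x y, linear (fun p => f p x y)) ->
  linear (fun p => tlift *:%R (f p) u).
Proof.
move=> lf; apply: lin_sumf => i; apply: lin_sumf => j a p q.
by rewrite lf scalerDr !scalerA mulrC.
Qed.

Lemma tflip_linear (U V : vectType K) : linear (@tflip K U V).
Proof. exact: tlift_linear. Qed.

Lemma tflipE (U V : vectType K) (x : U) (y : V) : tflip (tensv x y) = tensv y x.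
Proof.
by apply: tliftE_lin => z; [apply: tensv_linear_r|apply: tensv_linear_l].
Qed.

Lemma tmap_linear (U V U' V' : vectType K) (f : U -> U') (g : V -> V') :
  linear (tmap f g).
Proof. exact: tlift_linear. Qed.

Lemma tmapE (U V U' V' : vectType K) (f : U -> U') (g : V -> V') x y :
  linear f -> linear g -> tmap f g (tensv x y) = tensv (f x) (g y).
Proof.
move=> lf lg; apply: tliftE_lin => z a u v.
  by rewrite lf tensv_linear_l.
by rewrite lg tensv_linear_r.
Qed.

Lemma tassoc_linear (U V W : vectType K) : linear (@tassoc K U V W).
Proof. exact: tlift_linear. Qed.

Lemma tassocE (U V W : vectType K) (x : U) (y : V) (z : W) :
  tassoc (tensv (tensv x y) z) = tensv x (tensv y z).
Proof.
rewrite /tassoc tliftE_lin => [|{}z|u].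
- rewrite tliftE_lin // => v; first exact: tensv_linear_l.
  by move=> a y1 y2; rewrite tensv_linear_l tensv_linear_r.
- exact: tlift_linear.
by apply: tlift_linear_param => x1 y1;
  exact: lin_comp (tensv_linear_r y1) (tensv_linear_r x1).
Qed.

Lemma tmul_linear_l (A B : falgType K) (v : tens A B) :
  linear (fun u : tens A B => tmul u v).
Proof. exact: tlift_linear. Qed.

Lemma tmul_linear_r (A B : falgType K) (u : tens A B) : linear (tmul u).
Proof.
by apply: tlift_linear_param => x y; exact: tlift_linear.
Qed.

Lemma tmulE (A B : falgType K) (a c : A) (b d : B) :
  tmul (tensv a b) (tensv c d) = tensv (a * c) (b * d).
Proof.
have lml (R : falgType K) (z : R) : linear (fun x : R => x * z).
  by move=> k x y; rewrite mulrDl scalerAl.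
have lmr (R : falgType K) (z : R) : linear (fun x : R => z * x).
  by move=> k x y; rewrite mulrDr scalerAr.
rewrite /tmul tliftE_lin; last 2 first.
- move=> b'; apply: tlift_linear_param => x y.
  exact: (lin_comp (lml _ x) (tensv_linear_l _)).
- move=> a'; apply: tlift_linear_param => x y.
  exact: (lin_comp (lml _ y) (tensv_linear_r _)).
rewrite tliftE_lin // => z k x y.
  by rewrite lmr tensv_linear_l.
by rewrite lmr tensv_linear_r.
Qed.

(* The functional [f (x) g]. *)
Definition tpair (U V : vectType K) (f : U -> K^o) (g : V -> K^o) : tens U V -> K^o :=
  tlift *:%R (fun a b => f a * g b : K^o).

Lemma tpair_linear (U V : vectType K) (f : U -> K^o) (g : V -> K^o) :
  linear (tpair f g).
Proof. exact: tlift_linear. Qed.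

Lemma tpairE (U V : vectType K) (f : U -> K^o) (g : V -> K^o) x y :
  linear f -> linear g -> tpair f g (tensv x y) = f x * g y.
Proof.
move=> lf lg; apply: tliftE_lin => z a u v /=.
  by rewrite lf mulrDl scalerAl.
by rewrite lg mulrDr scalerAr.
Qed.

Lemma tpair_flip (U V : vectType K) (f : U -> K^o) (g : V -> K^o) t :
  linear f -> linear g -> tpair g f (tflip t) = tpair f g t.
Proof.
move=> lf lg; move: t.
apply: lin_tens_ext => [||x y]; [|exact: tpair_linear|].
  exact: lin_comp (@tflip_linear _ _) (@tpair_linear _ _ _ _).
by rewrite tflipE !tpairE // mulrC.
Qed.

Lemma tpair_tmap (U V U' V' : vectType K) (F : U -> U') (G : V -> V')
    (f : U' -> K^o) (g : V' -> K^o) t :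
    linear F -> linear G -> linear f -> linear g ->
  tpair f g (tmap F G t) = tpair (fun x => f (F x)) (fun y => g (G y)) t.
Proof.
move=> lF lG lf lg; move: t.
apply: lin_tens_ext => [||x y]; [|exact: tpair_linear|].
  exact: lin_comp (@tmap_linear _ _ _ _ _ _) (@tpair_linear _ _ _ _).
by rewrite tmapE // !tpairE //; exact: lin_comp.
Qed.

(** Through this identity coassociativity and associativity of a convolution product translate into
    each other. *)
Lemma tpair_tassoc (U V W : vectType K) (f : U -> K^o) (g : V -> K^o) (h : W -> K^o) t :
    linear f -> linear g -> linear h ->
  tpair f (tpair g h) (tassoc t) = tpair (tpair f g) h t.
Proof.
move=> lf lg lh; move: t.
have lgh := @tpair_linear _ _ g h; have lfg := @tpair_linear _ _ f g.
apply: lin_tens_ext => [||u z]; [|exact: tpair_linear|].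
  exact: lin_comp (@tassoc_linear _ _ _) (@tpair_linear _ _ _ _).
move: u; apply: (@lin_tens_ext U V K^o
    (fun u => tpair f (tpair g h) (tassoc (tensv u z)))
    (fun u => tpair (tpair f g) h (tensv u z))) => [||x y].
- apply: (lin_comp (F := fun u => tassoc (tensv u z))); last exact: tpair_linear.
  by apply: (lin_comp (tensv_linear_l z)); exact: tassoc_linear.
- by apply: (lin_comp (tensv_linear_l z)); exact: tpair_linear.
by rewrite tassocE !tpairE // mulrA.
Qed.

(** Together with multiplicativity of [comul], this makes the convolution of two characters a
    character. *)
Lemma tpair_tmul (A B : falgType K) (f : A -> K^o) (g : B -> K^o) (u v : tens A B) :
    linear f -> linear g -> {morph f : x y / x * y >-> x * y : K} ->
    {morph g : x y / x * y >-> x * y : K} ->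
  tpair f g (tmul u v) = tpair f g u * tpair f g v :> K.
Proof.
move=> lf lg fM gM; have lfg := @tpair_linear _ _ f g.
have lmul (k : K) : linear (fun x : K^o => x * k : K^o).
  by move=> a x y; rewrite mulrDl scalerAl.
have lmulr (k : K) : linear (fun x : K^o => k * x : K^o).
  by move=> a x y; rewrite mulrDr scalerAr.
move: u; apply: (@lin_tens_ext A B K^o (fun u => tpair f g (tmul u v))
    (fun u => (tpair f g u : K) * tpair f g v : K^o)) => [||a b].
- by apply: (lin_comp (F := fun u => tmul u v)) => //; exact: tmul_linear_l.
- exact: (lin_comp lfg (lmul (tpair f g v))).
move: v; apply: (@lin_tens_ext A B K^o (fun v => tpair f g (tmul (tensv a b) v))
    (fun v => (tpair f g (tensv a b) : K) * tpair f g v : K^o)) => [||c d].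
- by apply: (lin_comp (F := tmul _)) => //; exact: tmul_linear_r.
- exact: (lin_comp lfg (lmulr _)).
by rewrite tmulE !tpairE // fM gM mulrACA.
Qed.

Lemma linfunP (U V : vectType K) (f : U -> V) x : linear f -> linfun f x = f x.
Proof.
move=> lf.
pose F : {linear U -> V} := HB.pack f (GRing.isLinear.Build _ _ _ _ f lf).
exact: (lfunE F).
Qed.

End LinearMaps.

Lemma antitmap_antilinear (C : numClosedFieldType) (A : falgType C) (f : A -> A) :
  antilinear (antitmap f).
Proof. exact: tlift_semilin. Qed.

Lemma antitmapE (C : numClosedFieldType) (A : falgType C) (f : A -> A) x y :
  antilinear f -> antitmap f (tensv x y) = tensv (f x) (f y).
Proof.
move=> lf; apply: tliftE => z a u v.
  by rewrite lf tensv_linear_l.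
by rewrite lf tensv_linear_r.
Qed.

(** Conjugating after the antilinear map [F] gives linear functionals again, to which [tpair]
    applies; the outer conjugation compensates. *)
Lemma tpair_antitmap (C : numClosedFieldType) (A : falgType C) (F : A -> A)
    (f g : A -> C^o) t :
    antilinear F -> linear f -> linear g ->
  tpair f g (antitmap F t) =
    Num.conj (tpair (fun x => Num.conj (f (F x)) : C^o)
                    (fun x => Num.conj (g (F x)) : C^o) t : C).
Proof.
move=> lF lf lg; move: t.
have cl (h : A -> C^o) : linear h -> linear (fun x => Num.conj (h (F x) : C) : C^o).
  move=> lh a x y; rewrite lF lh rmorphD (rmorphM Num.conj (Num.conj a)).
  congr (_ * _ + _); exact: conjCK.
apply: (@semilin_tens_ext C Num.conj _ _ C^o) => [||x y].
- by apply: semilin_comp; [exact: antitmap_antilinear|exact: tpair_linear].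
- by move=> a u v; rewrite tpair_linear rmorphD rmorphM.
rewrite antitmapE // tpairE // [in RHS]tpairE ?(rmorphM Num.conj); [|exact: cl..].
by congr (_ * _); apply/esym/conjCK.
Qed.

(** * Semisimplicity from a faithful star-representation *)

Section FaithfulStarRepresentation.

Variables (C : numClosedFieldType) (V : vectType C) (mul : V -> V -> V).
Variables (star : V -> V) (n : nat) (phi : V -> 'M[C]_n).
Hypothesis phiP : star_representation mul star phi.
Hypothesis phi_inj : forall x, phi x = 0 -> x = 0.

Let phi_lin : linear phi. Proof. by case: phiP. Qed.

(** The Hilbert-Schmidt inner product pulled back along [phi]. It is definite because [phi] is
    injective, and [star a] acts as the adjoint of [a]. *)
Let dot (x y : V) : C := \tr ((phi y)^H *m phi x).

Let dot_linear y : linear (dot^~ y : V -> C^o).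
Proof. by move=> a x x'; rewrite /dot phi_lin mulmxDr -scalemxAr mxtraceD mxtraceZ. Qed.

Let dotxx x : dot x x = 0 -> x = 0.
Proof. by move/mxtrace_adj_mul_eq0/phi_inj. Qed.

Let dot_mul a x y : dot (mul a x) y = dot x (mul (star a) y).
Proof.
case: phiP => _ phiM phiS.
by rewrite /dot !phiM phiS adjmxM adjmxK mulmxA.
Qed.

Let dot_row (I : {vspace V}) (x : V) : 'rV[C]_(\dim I) :=
  \row_i dot x (vbasis I)`_i.

Let dot_row_linear I : linear (dot_row I).
Proof.
move=> a x y; apply/rowP=> i; rewrite !mxE; exact: dot_linear.
Qed.

(** Encoding the orthogonal complement as the kernel of a linear map into [\dim I] coordinates makes
    rank-nullity available for [add_ortho]. *)
Let ortho (I : {vspace V}) : {vspace V} := lker (linfun (dot_row I)).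

Let mem_ortho I x : x \in ortho I <-> forall y, y \in I -> dot x y = 0.
Proof.
rewrite memv_ker (linfunP _ (@dot_row_linear I)); split=> [/eqP/rowP E y|E]; last first.
  by apply/eqP/rowP=> i; rewrite !mxE E // vbasis_mem // mem_nth ?size_tuple.
move/coord_vbasis->; rewrite /dot.
have -> : phi (\sum_i coord (vbasis I) i y *: (vbasis I)`_i)
    = \sum_i coord (vbasis I) i y *: phi (vbasis I)`_i by exact: lin_sum.
rewrite linear_sum map_mx_sum mulmx_suml linear_sum big1 //= => i _.
rewrite linearZ /= map_mxZ -scalemxAl mxtraceZ.
by have := E i; rewrite !mxE /dot => ->; rewrite mulr0.
Qed.

Let ortho_ideal I : left_ideal mul I -> left_ideal mul (ortho I).
Proof.
move=> idI a x /mem_ortho xI; apply/mem_ortho => y yI.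
by rewrite dot_mul xI // idI.
Qed.

Let cap_ortho I : (I :&: ortho I)%VS = 0%VS.
Proof.
apply/eqP; rewrite -subv0; apply/subvP=> x; rewrite memv_cap memv0.
case/andP=> xI /mem_ortho/(_ _ xI).
by move/dotxx->.
Qed.

Let add_ortho I : (I + ortho I)%VS = fullv.
Proof.
apply/eqP; rewrite eqEdim subvf /= dimv_disjoint_sum ?cap_ortho //.
rewrite -(limg_ker_dim (linfun (dot_row I)) fullv) capfv addnC leq_add2r.
by apply: leq_trans (dimvS (subvf _)) _; rewrite dimvf /dim /= mul1n.
Qed.

Let minimal_ideal_sub J : left_ideal mul J -> J != 0%VS ->
  exists2 I, minimal_left_ideal mul I & (I <= J)%VS.
Proof.
have [d] := ubnP (\dim J); elim: d J => // d IHd J ltJd idJ J0.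
have [[K [idK KJ K0 nKJ]]|noK] :=
    EM (exists K, [/\ left_ideal mul K, (K <= J)%VS, K != 0%VS & K != J]).
  have [|I minI IK] := IHd K _ idK K0; last by exists I => //; exact: subv_trans IK KJ.
  rewrite -ltnS; apply: leq_trans ltJd; rewrite ltnS ltn_neqAle dimvS // andbT.
  by apply: contraNneq nKJ => dKJ; rewrite eqEdim KJ dKJ leqnn.
exists J => //; split=> // K idK KJ.
have [->|K0] := eqVneq K 0%VS; first by left.
by have [->|nKJ] := eqVneq K J; [right|case: noK; exists K].
Qed.

(** Induction on the dimension: a minimal left ideal [I] inside [J] is split off, and its orthogonal
    complement in [J] is a left ideal of smaller dimension. *)
Let ideal_decomposition J : left_ideal mul J ->
  exists (m : nat) (I : 'I_m -> {vspace V}),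
    [/\ forall i, minimal_left_ideal mul (I i),
        directv (\sum_(i < m) I i) & (\sum_(i < m) I i)%VS = J].
Proof.
have [d] := ubnP (\dim J); elim: d J => // d IHd J ltJd idJ.
have [->|J0] := eqVneq J 0%VS.
  exists 0, (fun _ => 0%VS); split=> [[]//||]; last by rewrite big_ord0.
  by rewrite directvE /= !big_ord0 dimv0.
have [I minI IJ] := minimal_ideal_sub idJ J0.
have [I0 idI _] := minI.
pose K := (ortho I :&: J)%VS.
have IKJ : (I + K)%VS = J by rewrite vspace_modl // add_ortho capfv.
have capIK : (I :&: K)%VS = 0%VS by rewrite /K capvA cap_ortho cap0v.
have idK : left_ideal mul K.
  move=> a x; rewrite !memv_cap => /andP[xI xJ].
  by rewrite (ortho_ideal idI) //= idJ.
have [|m [L [minL dL sL]]] := IHd K _ idK.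
  rewrite -ltnS; apply: leq_trans ltJd; rewrite ltnS -IKJ dimv_disjoint_sum //.
  by rewrite -[X in (X < _)%N]add0n ltn_add2r lt0n dimv_eq0.
(* The ideal [I] takes index [ord0], and the family [L] is shifted by one. *)
exists m.+1, (fun i => oapp L I (unlift ord0 i)); split.
- by move=> i; case: unliftP => [k|] _ /=.
- rewrite directvE /= !big_ord_recl unlift_none /=.
  under eq_bigr do rewrite liftK /=; under [in X in _ == X]eq_bigr do rewrite liftK /=.
  by rewrite sL dimv_disjoint_sum // -sL; move: dL; rewrite directvE /= => /eqP->.
rewrite big_ord_recl unlift_none /=; under eq_bigr do rewrite liftK /=.
by rewrite sL.
Qed.

Lemma faithful_star_rep_semisimple : semisimple_star_algebra mul star.
Proof.
split=> [|x x0]; first by apply: ideal_decomposition => x y _; exact: memvf.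
by exists n, phi; split=> //; apply: contraNneq x0 => /phi_inj->.
Qed.

End FaithfulStarRepresentation.

(** * Commutative star-algebras *)

Section CommutativeStarAlgebra.

Import VectorInternalTheory.

Variable C : numClosedFieldType.

(* The radical of the minimal polynomial of [M] takes a nilpotent value at [M],
   hence vanishes there if [M] lies in a reduced matrix algebra. *)
Lemma reduced_diagonalizable n (M : 'M[C]_n) (P : 'M[C]_n -> Prop) :
    P 1%:M -> (forall a A B, P A -> P B -> P (a *: A + B)) ->
    (forall A B, P A -> P B -> P (A *m B)) -> P M ->
    (forall A, P A -> A *m A = 0 -> A = 0) ->
  diagonalizable M.
Proof.
case: n M P => [|n] M P P1 PD PM PMM red.
  by exists 1%:M; [exact: unitmx1|apply/is_diag_mxP => -[]].
apply/diagonalizableP.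
have P0 : P 0 by have := PD (-1) _ _ P1 P1; rewrite scaleN1r addNr.
have Ph p : P (horner_mx M p).
  elim/poly_ind: p => [|p c IHp]; first by rewrite rmorph0.
  rewrite rmorphD rmorphM /= horner_mx_X horner_mx_C -[_ + _]addrC.
  by rewrite -scalemx1; apply: (PD c) => //; exact: PM.
have [rs Ers] := closed_field_poly_normal (mxminpoly M).
rewrite (monicP (mxminpoly_monic M)) scale1r in Ers.
exists (undup rs); first exact: undup_uniq.
set q := \prod_(x <- undup rs) _.
(* If [q ^+ (2 ^ k.+1)] kills [M], the value of [q ^+ (2 ^ k)] at [M] squares to zero, hence
   vanishes. The descent starts from an exponent [2 ^ size rs >= size rs], large enough because
   every linear factor of the minimal polynomial divides [q]. *)
have Mq k : mxminpoly M %| q ^+ (2 ^ k) -> mxminpoly M %| q.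
  elim: k => [|k IHk]; first by rewrite expr1.
  move=> /(mxminpoly_minP M) Mq; apply: IHk; apply/(mxminpoly_minP M).
  by apply: red => //; rewrite -Mq expnSr exprM expr2 rmorphM.
apply: (Mq (size rs)); apply: (dvdp_trans (y := q ^+ size rs)); last first.
  by apply: dvdp_exp2l; rewrite ltnW // ltn_expl.
have -> : q ^+ size rs = \prod_(x <- rs) q.
  by rewrite big_const_seq count_predT -Monoid.iteropE.
rewrite {1}Ers.
have q_rs x : x \in rs -> ('X - x%:P) %| q.
  by move=> xrs; rewrite dvdp_XsubCl root_prod_XsubC mem_undup.
rewrite !big_seq; elim/big_ind2: _ => [|????|] //; exact: dvdp_mul.
Qed.

Variables (V : vectType C) (mul : V -> V -> V) (star : V -> V) (one : V).
Hypothesis mul_linear : forall y, linear (mul^~ y).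
Hypothesis mulA : associative mul.
Hypothesis mulC : commutative mul.
Hypothesis mul1 : left_id one mul.
Hypothesis sepV : forall x, x != 0 ->
  exists (n : nat) (phi : V -> 'M[C]_n), star_representation mul star phi /\ phi x != 0.

Let mul_linear_r x : linear (mul x).
Proof. by move=> a y z; rewrite !(mulC x) mul_linear. Qed.

(** By commutativity [phi x] is a normal matrix, and a normal matrix of square zero vanishes. *)
Let mul_reduced x : mul x x = 0 -> x = 0.
Proof.
move=> xx; apply: (star_rep_sepP sepV) => n phi phiP.
rewrite (star_rep0 phiP); have [_ phiM phiS] := phiP.
have NN : phi x *m phi x = 0 by rewrite -phiM xx (star_rep0 phiP).
have NC : phi x *m (phi x)^H = (phi x)^H *m phi x by rewrite -!phiS -!phiM mulC.
apply: adj_mul_eq0; apply: adj_mul_eq0; rewrite adjmxM adjmxK.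
by rewrite !mulmxA -(mulmxA _ _ (phi x)^H) NC -!mulmxA NN !mulmx0.
Qed.

(** In every representation the image of [x] is a normal idempotent, hence an orthogonal
    projection. *)
Let idem_star x : mul x x = x -> star x = x.
Proof.
move=> xx; apply: (star_rep_sepP sepV) => n phi phiP.
have [_ phiM phiS] := phiP; rewrite phiS.
have EE : phi x *m phi x = phi x by rewrite -phiM xx.
have NC : phi x *m (phi x)^H = (phi x)^H *m phi x by rewrite -!phiS -!phiM mulC.
have EEH : (phi x)^H *m (phi x)^H = (phi x)^H by rewrite -adjmxM EE.
suff E : phi x = (phi x)^H *m phi x by rewrite E adjmxM adjmxK.
apply/eqP; rewrite -subr_eq0; apply/eqP; apply: adj_mul_eq0.
rewrite adjmxB adjmxM adjmxK mulmxBl !mulmxBr !mulmxA EEH.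
rewrite -(mulmxA _ (phi x) (phi x)^H) NC !mulmxA EEH -(mulmxA _ (phi x) (phi x)) EE.
by rewrite !subrr.
Qed.

(** The matrix of multiplication by [a], acting on row vectors of coordinates. The unit makes [T]
    injective, so its image is a reduced commutative matrix algebra. *)
Let T (a : V) : 'M[C]_(dim V) := \matrix_i v2r (mul (r2v (delta_mx 0 i)) a).

Let TE x a : v2r x *m T a = v2r (mul x a).
Proof.
have Ex : x = \sum_i v2r x 0 i *: r2v (delta_mx 0 i).
  rewrite -[LHS]v2rK {1}[v2r x]row_sum_delta linear_sum; apply: eq_bigr => i _.
  by rewrite linearZ.
rewrite {2}Ex (lin_sum _ _ (mul_linear a)) {1}[v2r x]row_sum_delta mulmx_suml linear_sum.
by apply: eq_bigr => i _; rewrite linearZ /= -scalemxAl -rowE rowK.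
Qed.

Let T_ext (A B : 'M[C]_(dim V)) : (forall x, v2r x *m A = v2r x *m B) -> A = B.
Proof.
by move=> E; apply/row_matrixP => i; rewrite !rowE -[delta_mx _ _]r2vK E.
Qed.

Let T_linear : linear T.
Proof.
move=> a x y; apply: T_ext => z.
by rewrite mulmxDr -scalemxAr !TE mul_linear_r linearP.
Qed.

Let TM a b : T (mul a b) = T a *m T b.
Proof. by apply: T_ext => z; rewrite mulmxA !TE mulA. Qed.

Let T1 : T one = 1%:M.
Proof. by apply: T_ext => z; rewrite mulmx1 TE mulC mul1. Qed.

Let T_diagonalizable a : diagonalizable (T a).
Proof.
apply: (@reduced_diagonalizable _ _ (fun A => exists w, A = T w)).
- by exists one.
- by move=> k _ _ [w ->] [w' ->]; exists (k *: w + w'); rewrite T_linear.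
- by move=> _ _ [w ->] [w' ->]; exists (mul w w'); rewrite TM.
- by exists a.
move=> _ [w ->]; rewrite -TM => Tww.
suff -> : w = 0 by have := T_linear (-1) 0 0; rewrite scaler0 addr0 scaleN1r addNr.
apply: mul_reduced; apply: (can_inj v2rK).
by rewrite -{1}[mul w w]mul1 -TE Tww mulmx0 linear0.
Qed.

(** The rows of a matrix diagonalizing all [T a] give common eigenvectors [h i]. For [i != j] the
    product of [h i] and [h j] lies on two distinct lines, hence is zero; reducedness makes the
    square of [h i] nonzero, so that a scalar turns [h i] into an idempotent [g i]. The eigenvalues
    are the coordinate forms [c i]. *)
Lemma commutative_star_algebra_idempotents :
  exists (g : 'I_(dim V) -> V) (c : 'I_(dim V) -> V -> C^o),
    [/\ forall i, linear (c i), forall i j, c i (g j) = (i == j)%:R,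
        forall x, x = \sum_i (c i x : C) *: g i,
        forall i j, mul (g i) (g j) = (i == j)%:R *: g i
      & forall i, star (g i) = g i].
Proof.
have [P Pu /allP/= Pdiag] : codiagonalizable [seq T b | b <- vbasis (fullv : {vspace V})].
  apply/codiagonalizableP; split=> [_ _ /mapP[a _ ->] /mapP[b _ ->]|_ /mapP[a _ ->]] //.
  by rewrite /comm_mx -[RHS]TM -[LHS]TM mulC.
pose c i (x : V) : C^o := (P *m T x *m invmx P) i i.
have c_lin i : linear (c i).
  move=> a x y; rewrite /c T_linear mulmxDr -scalemxAr mulmxDl -scalemxAl.
  by rewrite !mxE.
have Poff i j x : i != j -> (P *m T x *m invmx P) i j = 0.
  move=> ij; pose F x : C^o := (P *m T x *m invmx P) i j.
  have F_lin : linear F.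
    move=> a y z; rewrite /F T_linear mulmxDr -scalemxAr mulmxDl -scalemxAl.
    by rewrite !mxE.
  rewrite -[LHS]/(F x) (coord_vbasis (memvf x)) (lin_sum _ _ F_lin) big1 // => k _.
  have /Pdiag/(diagonalizable_forP _ Pu) : T (vbasis fullv)`_k
      \in [seq T b | b <- vbasis (fullv : {vspace V})].
    by apply: map_f; rewrite mem_nth ?size_tuple.
  by move/(_ i j ij); rewrite /F => ->; rewrite scaler0.
pose h i := r2v (row i P).
have hM i x : mul (h i) x = (c i x : C) *: h i.
  apply: (can_inj v2rK); rewrite linearZ /= -TE r2vK -row_mul.
  have -> : P *m T x = P *m T x *m invmx P *m P by rewrite mulmxKV.
  rewrite row_mul (_ : row i _ = (c i x : C) *: delta_mx 0 i) -?scalemxAl -?rowE //.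
  apply/rowP=> j; rewrite !mxE eqxx /= [j == i]eq_sym; case: eqVneq => [<-|/Poff ij].
    by rewrite mulr1 /c !mxE.
  by rewrite mulr0; have := ij x; rewrite !mxE.
have h0 i : h i != 0.
  apply/eqP => /(congr1 v2r); rewrite r2vK linear0 rowE => /(congr1 (mulmx^~ (invmx P))).
  rewrite mulmxK // mul0mx => /rowP/(_ i); rewrite !mxE !eqxx.
  by move/eqP; rewrite oner_eq0.
have c0 i j : i != j -> c i (h j) = 0.
  move=> ij; have := hM j (h i); rewrite mulC hM => /(congr1 v2r).
  rewrite !linearZ /= !r2vK !rowE => /(congr1 (mulmx^~ (invmx P))).
  rewrite -!scalemxAl !mulmxK // => /rowP/(_ i); rewrite !mxE !eqxx (negPf ij) /=.
  by rewrite mulr1 mulr0.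
have ci i : c i (h i) != 0.
  apply: contraNneq (h0 i) => cii; apply/eqP/mul_reduced.
  by rewrite hM cii scale0r.
pose g i := (c i (h i) : C)^-1 *: h i.
have cg i j : c i (g j) = (i == j)%:R.
  rewrite /g (linZ _ _ (c_lin i)); case: eqVneq => [<-|ij]; first exact: mulVf.
  by rewrite (c0 _ _ ij); exact: mulr0.
have gM i x : mul (g i) x = (c i x : C) *: g i.
  by rewrite /g (linZ _ _ (mul_linear x)) hM !scalerA mulrC.
have gg i j : mul (g i) (g j) = (i == j)%:R *: g i by rewrite gM cg.
exists g, c; split=> // [x|i]; last by apply: idem_star; rewrite gg eqxx scale1r.
(* The rows of [P] form a basis, whence some coefficients exist; duality of [c] and [g] then
   identifies them as the [c i x]. *)
have [d Ed] : exists d : 'I_(dim V) -> C, x = \sum_i d i *: g i.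
  exists (fun i => (v2r x *m invmx P) 0 i * c i (h i)); apply: (can_inj v2rK).
  rewrite linear_sum -{1}[v2r x](mulmxKV Pu) {1}[_ *m invmx P]row_sum_delta mulmx_suml.
  apply: eq_bigr => i _; rewrite /g scalerA mulfK // linearZ /= r2vK -scalemxAl.
  by rewrite -rowE.
rewrite {1}Ed; apply: eq_bigr => i _; congr (_ *: _).
rewrite Ed (lin_sum _ _ (c_lin i)) (bigD1 i) //= cg eqxx big1 => [|j ji].
  by rewrite addr0 [RHS]mulr1.
by rewrite cg eq_sym (negPf ji) scaler0.
Qed.

End CommutativeStarAlgebra.

(** * The semigroup algebra *)

Lemma semilin_ext (K : fieldType) (nu : {rmorphism K -> K}) (U W : lmodType K)
    (I : finType) (c : I -> U -> K) (g : I -> U) (F G : U -> W) :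
    (forall x, x = \sum_i c i x *: g i) ->
    linear_for (nu \; *:%R) F -> linear_for (nu \; *:%R) G ->
    (forall i, F (g i) = G (g i)) ->
  F =1 G.
Proof.
move=> E lF lG FG x; rewrite [x]E !(semilin_sum _ _ lF, semilin_sum _ _ lG).
by apply: eq_bigr => i _; rewrite FG.
Qed.

Lemma lin_ext (K : fieldType) (U W : lmodType K)
    (I : finType) (c : I -> U -> K) (g : I -> U) (F G : U -> W) :
    (forall x, x = \sum_i c i x *: g i) -> linear F -> linear G ->
    (forall i, F (g i) = G (g i)) ->
  F =1 G.
Proof. exact: (@semilin_ext K idfun). Qed.

Section Antilinear.

Variable C : numClosedFieldType.

Lemma antilin_comp (U V W : lmodType C) (F : U -> V) (G : V -> W) :
  antilinear F -> antilinear G -> linear (fun x => G (F x)).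
Proof. by move=> lF lG a x y; rewrite lF lG /= conjCK. Qed.

Lemma lmull_linear (A : falgType C) (y : A) : linear (fun x => x * y).
Proof. by move=> a x x'; rewrite mulrDl scalerAl. Qed.

Lemma lmulr_linear (A : falgType C) (x : A) : linear (fun y => x * y).
Proof. by move=> a y y'; rewrite mulrDr scalerAr. Qed.

Lemma antilin_sumf (U W : lmodType C) (I : finType) (F : I -> U -> W) :
  (forall i, antilinear (F i)) -> antilinear (fun x => \sum_i F i x).
Proof.
move=> lF a x y; rewrite /= scaler_sumr -big_split; apply: eq_bigr => i _.
by rewrite lF.
Qed.

Lemma antilin_scalef (U W : lmodType C) (f : U -> C^o) (w : W) :
  linear f -> antilinear (fun x => Num.conj (f x : C) *: w).
Proof. by move=> lf a x y; rewrite lf rmorphD rmorphM scalerDl /= scalerA. Qed.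

End Antilinear.

(** * Convolution and star-operation on the dual of a coalgebra *)

Section DualAlgebra.

Variables (C : numClosedFieldType) (A : falgType C) (D : bialgebra_data A).

Lemma dual_mulE (f g : 'Hom(A, C^o)) x : coalgebra D ->
  dual_mul D f g x = tpair f g (comul D x).
Proof.
case=> lD _ _ _ _; rewrite linfunP //.
exact: lin_comp lD (@tpair_linear _ _ _ f g).
Qed.

Lemma dual_starE (f : 'Hom(A, C^o)) x : coalgebra_coinvolution D (flat D) ->
  dual_star D f x = Num.conj (f (flat D x) : C).
Proof.
case=> lF _ _; rewrite linfunP // => a y z.
rewrite lF linearP rmorphD (rmorphM Num.conj (Num.conj a)).
by congr (_ * _ + _); exact: conjCK.
Qed.

End DualAlgebra.

(** * Axioms and semisimplicity of the semigroup algebra *)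

Section SemigroupAlgebra.

Variables (C : numClosedFieldType) (S : finType) (e : S) (op : Monoid.law e).
Hypothesis invS : inverse_semigroup op.

Local Notation CS := (semigroup_algebra C op).
Local Notation D := (sg_data C op).
Local Notation δ := (@sg_elt C S e op).

Let opA x y z : op x (op y z) = op (op x y) z.
Proof. exact: Monoid.mulmA. Qed.

Lemma sg_coord_linear s : linear (fun x : CS => x s : C^o).
Proof. by move=> a x y; rewrite !ffunE. Qed.

Lemma sg_ext (W : lmodType C) (F G : CS -> W) :
  linear F -> linear G -> (forall s, F (δ s) = G (δ s)) -> F =1 G.
Proof. exact: (@lin_ext C CS W S
  (fun s (x : CS) => x s) (fun s => δ s) F G (@sg_eltE C S e op)). Qed.

Lemma sg_antiext (W : lmodType C) (F G : CS -> W) :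
  antilinear F -> antilinear G -> (forall s, F (δ s) = G (δ s)) -> F =1 G.
Proof. exact: (@semilin_ext C Num.conj CS W S
  (fun s (x : CS) => x s) (fun s => δ s) F G (@sg_eltE C S e op)). Qed.

Lemma sg_sum_elt (W : lmodType C) (h : S -> W) s :
  \sum_t (δ s t : C) *: h t = h s.
Proof.
rewrite (bigD1 s) //= big1 => [|t ts]; first by rewrite ffunE eqxx scale1r addr0.
by rewrite ffunE (negPf ts) scale0r.
Qed.

Lemma sg_comul_linear : linear (comul D).
Proof. by apply: lin_sumf => s; apply: lin_scalef; exact: sg_coord_linear. Qed.

Lemma sg_comul_elt s : comul D (δ s) = tensv (δ s) (δ s).
Proof. exact: sg_sum_elt (fun s => tensv (δ s) (δ s)) s. Qed.

Lemma sg_counit_linear : linear (counit D : CS -> C^o).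
Proof. by apply: (@lin_sumf _ CS C^o) => s; exact: sg_coord_linear. Qed.

Lemma sg_counit_elt s : counit D (δ s) = 1.
Proof.
have := @sg_sum_elt C^o (fun=> 1) s; rewrite -[RHS]/(1 : C) => <-.
by apply: eq_bigr => t _; rewrite [RHS]mulr1.
Qed.

Lemma sg_sharp_antilinear : antilinear (sharp D).
Proof. by apply: antilin_sumf => s; apply: antilin_scalef; exact: sg_coord_linear. Qed.

Lemma sg_flat_antilinear : antilinear (flat D).
Proof. by apply: antilin_sumf => s; apply: antilin_scalef; exact: sg_coord_linear. Qed.

Lemma sg_sharp_elt s : sharp D (δ s) = δ (sinv op s).
Proof.
rewrite -[RHS](sg_sum_elt (fun s => δ (sinv op s))); apply: eq_bigr => t _.
by rewrite ffunE conjC_nat.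
Qed.

Lemma sg_flat_elt s : flat D (δ s) = δ s.
Proof.
rewrite -[RHS](sg_sum_elt (fun s => δ s)); apply: eq_bigr => t _.
by rewrite ffunE conjC_nat.
Qed.

Lemma sg_elt_mul s t : δ s * δ t = δ (op s t).
Proof. exact: sg_mul_elt. Qed.

(** Both sides of each axiom are linear or antilinear in every variable, so it suffices to compare
    them on the basis [δ s]. *)
Lemma sg_involutive_bialgebra : involutive_bialgebra D.
Proof.
have lD := sg_comul_linear; have lE := sg_counit_linear.
have lS := sg_sharp_antilinear; have lF := sg_flat_antilinear.
have lT := @antitmap_antilinear C CS.
have ml := @lmull_linear C CS; have mr := @lmulr_linear C CS.
split.
- split.
  + split=> //.
    * apply: sg_ext => [||s].
      - apply: (lin_comp (lin_comp lD (@tmap_linear _ _ _ _ _ _ _)) (@tassoc_linear _ _ _ _)).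
      - exact: (lin_comp lD (@tmap_linear _ _ _ _ _ _ _)).
      by rewrite sg_comul_elt !tmapE // sg_comul_elt tassocE.
    * apply: sg_ext => [|//|s]; first exact: lin_comp lD (@tlift_linear _ _ _ _ _).
      rewrite sg_comul_elt tliftE_lin ?sg_counit_elt ?scale1r // => [y|x] a u v.
        by rewrite lE scalerDl scalerA.
      by rewrite scalerDr !scalerA mulrC.
    apply: sg_ext => [|//|s]; first exact: lin_comp lD (@tlift_linear _ _ _ _ _).
    rewrite sg_comul_elt tliftE_lin ?sg_counit_elt ?scale1r // => [y|x] a u v.
      by rewrite scalerDr !scalerA mulrC.
    by rewrite lE scalerDl scalerA.
  + exact: sg_comul_elt.
  + move=> x y; move: x; apply: sg_ext => [||s].
    * exact: lin_comp (ml y) lD.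
    * exact: lin_comp lD (@tmul_linear_l _ _ _ _).
    move: y; apply: sg_ext => [||t].
    * exact: lin_comp (mr _) lD.
    * exact: lin_comp lD (@tmul_linear_r _ _ _ _).
    by rewrite sg_elt_mul !sg_comul_elt tmulE sg_elt_mul.
  + exact: sg_counit_elt.
  move=> x y; move: x; apply: (@sg_ext C^o) => [||s].
  + exact: lin_comp (ml y) lE.
  + exact: lin_comp lE (@lmull_linear _ C^o _).
  move: y; apply: (@sg_ext C^o) => [||t].
  + exact: lin_comp (mr _) lE.
  + exact: lin_comp lE (@lmulr_linear _ C^o _).
  by rewrite sg_elt_mul !sg_counit_elt mulr1.
- split=> // [x y|].
    move: x; apply: sg_antiext => [||s].
    + exact: comp_semilin (ml y) lS.
    + exact: semilin_comp lS (mr _).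
    move: y; apply: sg_antiext => [||t].
    + exact: comp_semilin (mr _) lS.
    + exact: semilin_comp lS (ml _).
    by rewrite sg_elt_mul !sg_sharp_elt sg_elt_mul sinvM.
  apply: sg_ext => [|//|s]; first exact: (antilin_comp lS lS).
  by rewrite !sg_sharp_elt sinvK.
- split=> //.
    apply: sg_antiext => [||s].
    + exact: comp_semilin lD (lT _).
    + exact: semilin_comp (semilin_comp lF lD) (@tflip_linear _ _ _).
    by rewrite sg_flat_elt sg_comul_elt tflipE antitmapE // sg_flat_elt.
  apply: sg_ext => [|//|s]; first exact: (antilin_comp lF lF).
  by rewrite !sg_flat_elt.
- apply: sg_antiext => [||s].
  + exact: semilin_comp lS lD.
  + exact: comp_semilin lD (lT _).
  by rewrite sg_sharp_elt !sg_comul_elt antitmapE // sg_sharp_elt.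
move=> x y; move: x; apply: sg_antiext => [||s].
- exact: semilin_comp lF (ml _).
- exact: comp_semilin (ml y) lF.
move: y; apply: sg_antiext => [||t].
- exact: semilin_comp lF (mr _).
- exact: comp_semilin (mr _) lF.
by rewrite sg_elt_mul !sg_flat_elt sg_elt_mul.
Qed.

Lemma sg_cocommutative : cocommutative D.
Proof.
apply: sg_ext => [||s].
- exact: lin_comp sg_comul_linear (@tflip_linear _ _ _).
- exact: sg_comul_linear.
by rewrite sg_comul_elt tflipE.
Qed.

Local Notation inv := (sinv op).

(* The left regular representation: [s] acts on [l^2(S)] as a partial isometry
   whose initial space is spanned by the [t] with [s^-1 s t = t]. *)
Let dom s t := op (op (inv s) s) t == t.

(** This makes [lreg] multiplicative. Recovering the condition on [s] from the one on [op s t] rests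
    on the commutation of the idempotents [t t^-1] and [s^-1 s]. *)
Let domM s t w : dom t w && dom s (op t w) = dom (op s t) w.
Proof.
rewrite /dom (sinvM invS); apply/andP/eqP => [[/eqP tw /eqP stw]|E].
  by rewrite -[RHS]tw -[op _ w in RHS]opA -[in RHS]stw !opA.
have C1 := idem_commute invS (mulsV_idem invS t) (mulVs_idem invS s).
split; apply/eqP.
  rewrite -{1}E.
  have -> : op (op (inv t) t) (op (op (op (inv t) (inv s)) (op s t)) w)
     = op (op (op (op (op (inv t) t) (inv t)) (inv s)) (op s t)) w by rewrite !opA.
  by rewrite (mulVsV invS).
rewrite -{1}E.
have -> : op (op (inv s) s) (op t (op (op (op (inv t) (inv s)) (op s t)) w))
   = op (op (op (op (inv s) s) (op t (inv t))) (op (inv s) s)) (op t w).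
  by rewrite !opA.
rewrite -C1 -(opA (op t _)) (mulVs_idem invS) -[in RHS]E.
by rewrite !opA.
Qed.

(** The partial maps of [s] and [inv s] have opposite graphs, hence adjoint matrices. *)
Let domV s t u : dom (inv s) t && (op (inv s) t == u) = dom s u && (op s u == t).
Proof.
rewrite /dom (sinvK invS); apply/andP/andP => -[/eqP E /eqP Eu]; subst.
  by rewrite !opA (mulVsV invS) E !eqxx.
by rewrite !opA (mulsVs invS) E !eqxx.
Qed.

Let lreg s : 'M[C]_#|S| :=
  \matrix_(i, j) (dom s (enum_val j) && (op s (enum_val j) == enum_val i))%:R.

Let lregM s t : lreg (op s t) = lreg s *m lreg t.
Proof.
apply/matrixP=> i j; rewrite !mxE (bigD1 (enum_rank (op t (enum_val j)))) //=.
rewrite big1 => [|k kj]; last first.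
  rewrite !mxE; case: (op t (enum_val j) =P enum_val k) => [Ek|_];
    last by rewrite andbF mulr0.
  by move: kj; rewrite Ek enum_valK eqxx.
rewrite addr0 !mxE enum_rankK eqxx andbT -natrM mulnb -domM opA.
by congr (nat_of_bool _)%:R; rewrite -andbA andbC -andbA andbC -!andbA andbCA andbC.
Qed.

Let lregV s : lreg (inv s) = (lreg s)^H.
Proof. by apply/matrixP=> i j; rewrite !mxE domV conjC_nat. Qed.

Let rep (x : CS) : 'M[C]_#|S| := \sum_s (x s : C) *: lreg s.

Let rep_elt s : rep (δ s) = lreg s.
Proof. exact: sg_sum_elt. Qed.

Let rep_linear : linear rep.
Proof. by apply: lin_sumf => s; apply: lin_scalef; exact: sg_coord_linear. Qed.

Let rep_star : star_representation *%R (sharp D) rep.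
Proof.
have ml := @lmull_linear C CS; have mr := @lmulr_linear C CS.
have lS := sg_sharp_antilinear.
split=> // [x y|].
  move: x; apply: sg_ext => [||s].
  - exact: lin_comp (ml y) rep_linear.
  - by move=> a x x'; rewrite rep_linear mulmxDl scalemxAl.
  move: y; apply: sg_ext => [||t].
  - exact: lin_comp (mr _) rep_linear.
  - by move=> a x x'; rewrite rep_linear mulmxDr scalemxAr.
  by rewrite sg_elt_mul !rep_elt lregM.
apply: sg_antiext => [||s].
- exact: semilin_comp lS rep_linear.
- by move=> a x y; rewrite rep_linear linearD linearZ /= map_mxD map_mxZ.
by rewrite sg_sharp_elt !rep_elt lregV.
Qed.

(** Choose [s0] in the support of [x] with a domain of largest size, and read the entry of [rep x]
    at row [s0] and column [f = s0^-1 s0]. Any other [s] of the support contributing there satisfies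
    [s f = s0] and has a domain containing that of [s0]; by maximality the domains agree, so
    [s^-1 s = f] and [s = s0]. *)
Let rep_faithful x : rep x = 0 -> x = 0.
Proof.
move=> rx; apply/eqP; apply: contraT => x0.
have [s1 xs1] : exists s, x s != 0.
  apply/existsP; apply: contraR x0 => /existsPn x0.
  by apply/eqP/ffunP => s; have /negPn/eqP-> := x0 s; rewrite ffunE.
case: (@arg_maxnP S s1 (fun s => x s != 0)
  (fun s => #|[set t | dom s t]|) xs1) => s0 xs0 max0.
pose f := op (inv s0) s0.
have s0f : op s0 f = s0 by rewrite /f opA (mulsVs invS).
have dom0f : dom s0 f by rewrite /dom (mulVs_idem invS).
have /matrixP/(_ (enum_rank s0) (enum_rank f)) := rx.
rewrite /rep summxE mxE (bigD1 s0) //= big1 => [/eqP|s ss0].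
  rewrite addr0 !mxE !enum_rankK s0f dom0f eqxx mulr1 => xs00.
  by rewrite xs00 in xs0.
rewrite !mxE !enum_rankK.
have [->|xs] := eqVneq (x s) 0; first by rewrite mul0r.
case: (boolP (dom s f && _)) => [/andP[domf /eqP sf]|_]; last by rewrite mulr0.
have sub : [set t | dom s0 t] \subset [set t | dom s t].
  apply/subsetP=> t; rewrite !inE /dom -/f => /eqP ft.
  by rewrite -{1}ft opA (eqP domf) ft.
have /eqP : [set t | dom s0 t] == [set t | dom s t].
  by rewrite eqEcard sub; exact: max0.
move/setP/(_ (op (inv s) s)); rewrite !inE /dom -/f (mulVs_idem invS) eqxx => /eqP.
rewrite (idem_commute invS (mulVs_idem invS s0) (mulVs_idem invS s)) -/f (eqP domf) => Ef.
by case/eqP: ss0; rewrite -sf Ef opA (mulsVs invS).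
Qed.

(** As the [δ s] are grouplike and fixed by [flat], the dual is the algebra of functions on [S] with
    pointwise product and conjugation, represented by diagonal matrices. *)
Let dual_rep (f : 'Hom(CS, C^o)) : 'M[C]_#|S| := diag_mx (\row_i f (δ (enum_val i))).

Let dual_rep_star : star_representation (dual_mul D) (dual_star D) dual_rep.
Proof.
have [[coalg _ _ _ _] _ coinv _ _] := sg_involutive_bialgebra.
split=> [a f g|f g|f].
- rewrite /dual_rep -linearZ -linearD; congr diag_mx.
  by apply/rowP=> i; rewrite !mxE !lfunE /= !lfunE.
- rewrite /dual_rep mulmx_diag; congr diag_mx; apply/rowP=> i; rewrite !mxE.
  by rewrite dual_mulE // sg_comul_elt tpairE //; apply: linearP.
rewrite /dual_rep tr_diag_mx map_diag_mx; congr diag_mx; apply/rowP=> i; rewrite !mxE.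
by rewrite dual_starE // sg_flat_elt.
Qed.

Let dual_rep_faithful f : dual_rep f = 0 -> f = 0.
Proof.
move=> rf; apply/lfunP => x; rewrite lfunE /=; move: x; apply: (@sg_ext C^o).
- exact: linearP.
- by move=> a x y; rewrite scaler0 addr0.
move=> s; have /matrixP/(_ (enum_rank s) (enum_rank s)) := rf.
by rewrite !mxE eqxx enum_rankK mulr1n.
Qed.

Lemma sg_semisimple : semisimple D.
Proof.
split; first exact: faithful_star_rep_semisimple rep_star rep_faithful.
exact: faithful_star_rep_semisimple dual_rep_star dual_rep_faithful.
Qed.

End SemigroupAlgebra.

(** * The dual semigroup algebra *)

Section DualBasis.

Variable K : fieldType.

Definition dual_basis (U : lmodType K) (I : finType) (c : I -> U -> K^o) (g : I -> U) :=
  (forall i, linear (c i)) /\ forall x, x = \sum_i (c i x : K) *: g i.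

Lemma dual_basis_sep (U : lmodType K) (I : finType) (c : I -> U -> K^o) (g : I -> U) x y :
  dual_basis c g -> (forall i, c i x = c i y) -> x = y.
Proof. by move=> [_ E] xy; rewrite (E x) (E y); apply: eq_bigr => i _; rewrite xy. Qed.

(** Its use is to reduce equalities of tensors to equalities of scalars, by pairing with products of
    coordinate functionals. *)
Lemma tens_dual_basis (U V : vectType K) (I J : finType) (c : I -> U -> K^o)
    (g : I -> U) (d : J -> V -> K^o) (h : J -> V) :
    dual_basis c g -> dual_basis d h ->
  dual_basis (fun ij : I * J => tpair (c ij.1) (d ij.2))
    (fun ij => tensv (g ij.1) (h ij.2) : tens U V).
Proof.
move=> [lc Ec] [ld Ed]; split=> [ij|]; first exact: tpair_linear.
apply: lin_tens_ext => [||x y]; first exact: lin_id.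
  by apply: lin_sumf => ij; apply: lin_scalef; exact: tpair_linear.
rewrite -(pair_big predT predT
  (fun i j => (tpair (c i) (d j) (tensv x y) : K) *: tensv (g i) (h j))) /=.
rewrite {1}(Ec x) (lin_sum _ _ (tensv_linear_l y)); apply: eq_bigr => i _.
rewrite {1}(Ed y) (lin_sum _ _ (tensv_linear_r _)) scaler_sumr.
by apply: eq_bigr => j _; rewrite tpairE // scalerA.
Qed.

Lemma eq_tpair (U V : vectType K) (f f' : U -> K^o) (g g' : V -> K^o) t :
  f =1 f' -> g =1 g' -> tpair f g t = tpair f' g' t.
Proof.
move=> ff gg; apply: eq_bigr => i _; apply: eq_bigr => j _.
by rewrite /= ff gg.
Qed.

(** Rewrites the left counit axiom, tested by a functional [h], as a pairing. *)
Lemma lin_tlift_scale_l (U V : vectType K) (f : U -> K^o) (h : V -> K^o) t :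
    linear f -> linear h ->
  h (tlift *:%R (fun a b => (f a : K) *: b) t) = tpair f h t.
Proof.
move=> lf lh; move: t.
apply: (@lin_tens_ext K U V K^o (fun t => h (tlift *:%R (fun a b => (f a : K) *: b) t)))
  => [||x y].
- exact: lin_comp (@tlift_linear _ _ _ _ _) lh.
- exact: tpair_linear.
rewrite tliftE_lin ?tpairE ?(linZ _ _ lh) // => [y'|x'] a u v.
  by rewrite lf scalerDl scalerA.
by rewrite scalerDr !scalerA mulrC.
Qed.

Lemma lin_tlift_scale_r (U V : vectType K) (f : V -> K^o) (h : U -> K^o) t :
    linear f -> linear h ->
  h (tlift *:%R (fun a b => (f b : K) *: a) t) = tpair h f t.
Proof.
move=> lf lh; move: t.
apply: (@lin_tens_ext K U V K^o (fun t => h (tlift *:%R (fun a b => (f b : K) *: a) t)))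
  => [||x y].
- exact: lin_comp (@tlift_linear _ _ _ _ _) lh.
- exact: tpair_linear.
rewrite tliftE_lin ?tpairE ?(linZ _ _ lh) 1?mulrC // => [y'|x'] a u v.
  by rewrite scalerDr !scalerA mulrC.
by rewrite lf scalerDl scalerA.
Qed.

End DualBasis.

Section DualSemigroupAlgebra.

Variables (C : numClosedFieldType) (S : finType) (e : S) (op : Monoid.law e).

Local Notation FS := (dual_semigroup_algebra C op).
Local Notation D := (dsg_data C op).
Local Notation δ := (@dsg_delta C S e op).

Let ev (s : S) (f : FS) : C^o := f s.

Lemma dsg_coord_linear s : linear (fun f : FS => f s : C^o).
Proof. by move=> a x y; rewrite !ffunE. Qed.

Lemma dsg_deltaE (f : FS) : f = \sum_s (f s : C) *: δ s.
Proof.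
apply/ffunP => t; rewrite sum_ffunE (bigD1 t) //= big1 => [|s st].
  by rewrite addr0 !ffunE eqxx [RHS]mulr1.
by rewrite !ffunE eq_sym (negPf st) [LHS]mulr0.
Qed.

Let ev_basis : dual_basis ev δ.
Proof. by split=> [s|f]; [exact: dsg_coord_linear|exact: dsg_deltaE]. Qed.

Lemma dsg_tens_sep (u v : tens FS FS) :
  (forall s t, tpair (ev s) (ev t) u = tpair (ev s) (ev t) v) -> u = v.
Proof.
by move=> uv; apply: (dual_basis_sep (tens_dual_basis ev_basis ev_basis)) => -[s t].
Qed.

Let ev3_sep (u v : tens FS (tens FS FS)) :
  (forall s t w, tpair (ev s) (tpair (ev t) (ev w)) u
    = tpair (ev s) (tpair (ev t) (ev w)) v) -> u = v.
Proof.
have B := tens_dual_basis ev_basis (tens_dual_basis ev_basis ev_basis).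
by move=> uv; apply: (dual_basis_sep B) => -[s [t w]]; exact: uv.
Qed.

Lemma dsg_tpair_comul s t f : tpair (ev s) (ev t) (comul D f) = f (op s t).
Proof. exact: dsg_comulE. Qed.

Lemma dsg_comul_linear : linear (comul D).
Proof.
apply: lin_sumf => s; apply: lin_sumf => t; apply: lin_scalef.
exact: dsg_coord_linear.
Qed.

Lemma dsg_mulE (f g : FS) s : (f * g) s = f s * g s :> C.
Proof. by rewrite ffunE. Qed.

Lemma dsg_mulC (f g : FS) : f * g = g * f.
Proof. by apply/ffunP=> s; rewrite !ffunE; exact: mulrC. Qed.

Hypothesis invS : inverse_semigroup op.

(** Tested on evaluations at points, coassociativity and the counit axioms become the monoid laws of
    [op], and compatibility of [flat] with [comul] becomes [sinvM]. *)
Lemma dsg_involutive_bialgebra : involutive_bialgebra D.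
Proof.
have lD := dsg_comul_linear; have lev s : linear (ev s) by exact: dsg_coord_linear.
have lev2 s t := @tpair_linear C FS FS (ev s) (ev t).
have evc s t f : tpair (ev s) (ev t) (comul D f) = f (op s t) by exact: dsg_tpair_comul.
have lS : antilinear (sharp D).
  by move=> a x y; apply/ffunP=> s; rewrite !ffunE rmorphD rmorphM.
have lF : antilinear (flat D).
  by move=> a x y; apply/ffunP=> s; rewrite !ffunE rmorphD rmorphM.
split.
- split.
  + split=> // [|x|x|x]; first exact: (lev e).
    * apply: ev3_sep => s t w; rewrite tpair_tassoc // !tpair_tmap //.
      rewrite (@eq_tpair _ _ _ _ (ev (op s t)) _ (ev w)); [|exact: evc|by []].
      rewrite [RHS](@eq_tpair _ _ _ _ (ev s) _ (ev (op t w))); [|by []|exact: evc].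
      by rewrite !evc Monoid.mulmA.
    * apply: (dual_basis_sep ev_basis) => s.
      rewrite (@lin_tlift_scale_l _ _ _ (ev e) (ev s)) //.
      by rewrite dsg_tpair_comul Monoid.mul1m.
    apply: (dual_basis_sep ev_basis) => s.
    rewrite (@lin_tlift_scale_r _ _ _ (ev e) (ev s)) //.
    by rewrite dsg_tpair_comul Monoid.mulm1.
  + by apply: dsg_tens_sep => s t; rewrite dsg_tpair_comul tpairE // /ev !ffunE [RHS]mulr1.
  + move=> x y; apply: dsg_tens_sep => s t.
    by rewrite tpair_tmul // ?dsg_tpair_comul ?dsg_mulE // => f g; rewrite /ev dsg_mulE.
  + by rewrite /= ffunE.
  by move=> x y; rewrite /= dsg_mulE.
- split=> // [x y|x]; last by apply/ffunP=> s; rewrite !ffunE conjCK.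
  by apply/ffunP=> s; rewrite !(dsg_mulE, ffunE) rmorphM mulrC.
- split=> // x; last by apply/ffunP=> s; rewrite !ffunE sinvK // conjCK.
  apply: dsg_tens_sep => s t; rewrite tpair_flip // dsg_tpair_comul tpair_antitmap //.
  rewrite (@eq_tpair _ _ _ _ (ev (sinv op s)) _ (ev (sinv op t))).
  + by rewrite dsg_tpair_comul ffunE sinvM.
  + by move=> f; rewrite /ev ffunE conjCK.
  by move=> f; rewrite /ev ffunE conjCK.
- move=> x; apply: dsg_tens_sep => s t; rewrite dsg_tpair_comul tpair_antitmap //.
  rewrite (@eq_tpair _ _ _ _ (ev s) _ (ev t)).
  + by rewrite dsg_tpair_comul ffunE.
  + by move=> f; rewrite /ev ffunE conjCK.
  by move=> f; rewrite /ev ffunE conjCK.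
by move=> x y; apply/ffunP=> s; rewrite !(dsg_mulE, ffunE) rmorphM.
Qed.

End DualSemigroupAlgebra.

(** * Cocommutative bialgebras *)

Section DualConvolution.

Variables (C : numClosedFieldType) (A : falgType C) (D : bialgebra_data A).
Hypothesis coalgD : coalgebra D.

Let lD : linear (comul D). Proof. by case: coalgD. Qed.
Let lE : linear (counit D : A -> C^o). Proof. by case: coalgD. Qed.

Lemma lfun_linear (U V : vectType C) (f : 'Hom(U, V)) : linear f.
Proof. exact: linearP. Qed.

Lemma dual_mul_linear g : linear ((dual_mul D)^~ g).
Proof.
move=> a f f'; apply/lfunP=> x; rewrite dual_mulE // !lfunE /= !lfunE /= !dual_mulE //.
apply: (@tlift_linear_param C 'Hom(A, C^o) A A C^o
  (fun (p : 'Hom(A, C^o)) (y z : A) => p y * g z : C^o)) => y z b p q.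
by rewrite !lfunE /= !lfunE /= mulrDl scalerAl.
Qed.

Lemma dual_mulA : associative (dual_mul D).
Proof.
have [_ _ coA _ _] := coalgD.
move=> f g h; apply/lfunP=> x; rewrite !dual_mulE //.
transitivity (tpair f (tpair g h) (tmap id (comul D) (comul D x))).
  rewrite tpair_tmap //; [|exact: lfun_linear|exact: tpair_linear].
  by apply: eq_tpair => // y; exact: dual_mulE.
rewrite -coA tpair_tassoc ?tpair_tmap //; try exact: lfun_linear; last exact: tpair_linear.
by apply: eq_tpair => // y; rewrite dual_mulE.
Qed.

Lemma dual_mulC : cocommutative D -> commutative (dual_mul D).
Proof.
move=> coC f g; apply/lfunP=> x; rewrite !dual_mulE // -[in LHS]coC.
by rewrite tpair_flip //; exact: lfun_linear.
Qed.

Lemma dual_mul1l : left_id (linfun (counit D : A -> C^o)) (dual_mul D).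
Proof.
have [_ _ _ coL _] := coalgD.
move=> f; apply/lfunP=> x; rewrite dual_mulE //.
rewrite (@eq_tpair _ _ _ _ (counit D : A -> C^o) _ f) // => [|y]; last exact: linfunP.
by rewrite -lin_tlift_scale_l ?coL //; exact: lfun_linear.
Qed.

Lemma dual_mul1r : right_id (linfun (counit D : A -> C^o)) (dual_mul D).
Proof.
have [_ _ _ _ coR] := coalgD.
move=> f; apply/lfunP=> x; rewrite dual_mulE //.
rewrite (@eq_tpair _ _ _ _ f _ (counit D : A -> C^o)) // => [|y]; last exact: linfunP.
by rewrite -lin_tlift_scale_r ?coR //; exact: lfun_linear.
Qed.

(** The counit axiom gives [counit D x *: x = x], and the nonzero [x] cancels. *)
Lemma grouplike_counit x : comul D x = tensv x x -> x != 0 -> counit D x = 1.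
Proof.
have [_ _ _ coL _] := coalgD => Dx x0; have := coL x.
rewrite Dx tliftE_lin => [|y a u v|y a u v]; last 2 first.
- by rewrite lE scalerDl scalerA.
- by rewrite scalerDr !scalerA mulrC.
move/eqP; rewrite -subr_eq0 -[X in _ - X]scale1r -scalerBl scaler_eq0 (negPf x0) orbF.
by rewrite subr_eq0 => /eqP.
Qed.

End DualConvolution.

(** * Biduality in finite dimension *)

Section Bidual.

Variables (K : fieldType) (A : vectType K).

Let coordf k : 'Hom(A, K^o) :=
  linfun (fun x => coord (vbasis (fullv : {vspace A})) k x : K^o).

Let coordfE k x : coordf k x = coord (vbasis (fullv : {vspace A})) k x.
Proof. by rewrite linfunP // => a y z; rewrite linearP. Qed.

Lemma lfun_sep (x y : A) : (forall f : 'Hom(A, K^o), f x = f y) -> x = y.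
Proof.
move=> E; rewrite (coord_vbasis (memvf x)) (coord_vbasis (memvf y)).
by apply: eq_bigr => k _; rewrite -!coordfE E.
Qed.

(** The coordinates of the point [p] are the values of [c] on the coordinate forms. *)
Lemma bidual_point (c : 'Hom(A, K^o) -> K^o) :
  linear c -> exists p, forall f, c f = f p.
Proof.
move=> lc; exists (\sum_(k < _) (c (coordf k) : K) *: (vbasis (fullv : {vspace A}))`_k) => f.
have {1}-> : f = \sum_(k < _) (f (vbasis (fullv : {vspace A}))`_k : K) *: coordf k.
  apply/lfunP=> x; rewrite sum_lfunE {1}(coord_vbasis (memvf x)) linear_sum.
  apply: eq_bigr => k _; rewrite linearZ /= lfunE /= coordfE; exact: mulrC.
rewrite (lin_sum _ _ lc) linear_sum; apply: eq_bigr => k _.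
by rewrite linearZ; exact: mulrC.
Qed.

End Bidual.

Section MonoidLaw.

Variables (I : finType) (e : I) (f : I -> I -> I).
Hypothesis fA : associative f.
Hypothesis f1x : left_id e f.
Hypothesis fx1 : right_id e f.

(** Serves to equip a finite type with a monoid law in the middle of a proof, where the product
    comes from a choice. *)
Lemma monoid_law_of : exists op : Monoid.law e, op =2 f.
Proof.
pose op : Monoid.law e := HB.pack f (Monoid.isLaw.Build I e f fA f1x fx1).
by exists op.
Qed.

End MonoidLaw.

(** * Grouplike elements and the structure of cocommutative bialgebras *)

Section Cocommutative.

Variables (C : numClosedFieldType) (A : falgType C) (D : bialgebra_data A).
Hypothesis bialgD : involutive_bialgebra D.
Hypothesis semiD : semisimple D.
Hypothesis cocommD : cocommutative D.

Let coalgD : coalgebra D. Proof. by case: bialgD => [[]]. Qed.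
Let lD : linear (comul D). Proof. by case: coalgD. Qed.
Let lE : linear (counit D : A -> C^o). Proof. by case: coalgD. Qed.

(** Let [g] be the basis of idempotents of the commutative dual algebra; biduality turns their
    coordinate forms into points [p i]. Orthogonal idempotence of [g] dualizes to [p i] being
    grouplike, and self-adjointness of [g] to [flat] fixing [p i]. *)
Lemma grouplike_basis : exists (I : finType) (g : I -> A -> C^o) (p : I -> A),
  [/\ dual_basis g p, forall i j, g i (p j) = (i == j)%:R,
      forall i, comul D (p i) = tensv (p i) (p i),
      forall i, flat D (p i) = p i
    & forall x, comul D x = tensv x x -> x != 0 -> exists i, p i = x].
Proof.
have [_ [_ sepV]] := semiD; have [_ _ coinv _ _] := bialgD.
have [g [c [lc cg cE gg gs]]] := commutative_star_algebra_idempotents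
  (dual_mul_linear coalgD) (dual_mulA coalgD) (dual_mulC coalgD cocommD)
  (dual_mul1l coalgD) sepV.
have [p pE] : exists p : 'I_(dim 'Hom(A, C^o)) -> A, forall i f, c i f = f (p i).
  apply: (fin_all_exists (P := fun i x => forall f, c i f = f x)) => i.
  exact: bidual_point.
have gp i j : g i (p j) = (i == j)%:R by rewrite -pE cg eq_sym.
have gB : dual_basis (fun i => g i : A -> C^o) p.
  split=> [i|x]; first exact: lfun_linear.
  apply: lfun_sep => f; rewrite [in LHS](cE f) sum_lfunE linear_sum.
  by apply: eq_bigr => i _; rewrite linearZ /= lfunE /= pE; exact: mulrC.
have gB2 := tens_dual_basis gB gB.
have gg2 x i j : tpair (g i) (g j) (comul D x) = (i == j)%:R *: g i x.
  by rewrite -dual_mulE // gg lfunE.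
have p0 i : p i != 0.
  by apply/eqP => pi0; have := gp i i; rewrite pi0 linear0 eqxx => /esym/eqP; rewrite oner_eq0.
exists 'I_(dim 'Hom(A, C^o)), (fun i => g i : A -> C^o), p; split=> //.
- move=> i; apply: (dual_basis_sep gB2) => -[j k] /=.
  rewrite gg2 tpairE ?gp; try exact: lfun_linear.
  case: (eqVneq j k) => [<-|jk].
    by rewrite scale1r; case: (j == i); rewrite ?mulr1 ?mulr0.
  rewrite scale0r; case: (eqVneq j i) => [<-|_]; last by rewrite mul0r.
  by rewrite eq_sym (negPf jk) mulr0.
- move=> i; apply: (dual_basis_sep gB) => j.
  by rewrite gp -[LHS]conjCK -dual_starE // gs gp conjC_nat.
move=> x Dx x0.
(* The coordinates of a grouplike [x] are idempotent and pairwise of zero product, so exactly one of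
   them is nonzero and it equals 1. *)
have gx j k : (g j x : C) * g k x = (j == k)%:R * (g j x : C).
  by rewrite -[LHS]tpairE ?gg2 // -?Dx ?gg2 //; exact: lfun_linear.
have [i gi0] : exists i, g i x != 0.
  apply/existsP; apply: contraR x0 => /existsPn gx0; apply/eqP.
  rewrite (gB.2 x) big1 // => i _.
  by have /negPn/eqP-> := gx0 i; rewrite scale0r.
exists i; rewrite [RHS](gB.2 x) (bigD1 i) //= big1 => [|j ji].
  rewrite addr0; have := gx i i; rewrite eqxx mul1r -{3}[g i x]mulr1.
  by move/(mulfI gi0) => ->; rewrite scale1r.
have := gx i j; rewrite eq_sym (negPf ji) mul0r => /eqP; rewrite mulf_eq0 (negPf gi0).
by move/eqP=> ->; rewrite scale0r.
Qed.

Lemma cocommutative_sg_iso : exists (S : finType) (e : S) (op : Monoid.law e),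
  inverse_semigroup op /\ involutive_bialgebra_iso D (sg_data C op).
Proof.
have [_ [[lS sharpM sharpK] [[lF _ flatK] [comul_sharp flatM]]]] :
  bialgebra D /\ algebra_involution *%R (sharp D) /\ coalgebra_coinvolution D (flat D) /\
  (forall x, comul D (sharp D x) = antitmap (sharp D) (comul D x)) /\
  (forall x y, flat D x * flat D y = flat D (x * y)) by case: bialgD.
have [_ D1 DM E1 EM] : bialgebra D by case: bialgD.
have [[_ sepA] _] := semiD.
have [I [g [p [gB gp Dp Fp grouplikeP]]]] := grouplike_basis.
have p0 i : p i != 0.
  apply/eqP => pi0; have := gp i i; rewrite pi0 (lin0 (gB.1 i)) eqxx => /esym/eqP.
  by rewrite oner_eq0.
have Ep i : counit D (p i) = 1 by exact: grouplike_counit.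
have p_inj : injective p.
  move=> i j pij; have := gp i j; rewrite -pij gp eqxx; case: eqP => // _ /eqP.
  by rewrite oner_eq0.
have /sig_eqW[e pe] : exists i, p i = 1 by apply: grouplikeP => //; exact: oner_neq0.
(* A product of grouplikes is grouplike, and it is nonzero because its counit is 1. *)
have mulP i j : {k | p k = p i * p j}.
  apply: sig_eqW; apply: grouplikeP; first by rewrite DM !Dp tmulE.
  apply/eqP => pij0; have := EM (p i) (p j); rewrite pij0 !Ep mulr1 (lin0 lE) => /esym/eqP.
  by rewrite oner_eq0.
have invP i : {k | p k = sharp D (p i)}.
  apply: sig_eqW; apply: grouplikeP; first by rewrite comul_sharp Dp antitmapE.
  apply: contraNneq (p0 i) => pi0; rewrite -[p i]sharpK pi0; apply/eqP.
  exact: (semilin0 (nu := Num.conj) lS).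
pose m i j := sval (mulP i j); have mE i j : p (m i j) = p i * p j := svalP (mulP i j).
pose v i := sval (invP i); have vE i : p (v i) = sharp D (p i) := svalP (invP i).
have [|||op opE] := @monoid_law_of I e m.
- by move=> i j k; apply: p_inj; rewrite !mE mulrA.
- by move=> i; apply: p_inj; rewrite mE pe mul1r.
- by move=> i; apply: p_inj; rewrite mE pe mulr1.
have pM i j : p (op i j) = p i * p j by rewrite opE mE.
(* The grouplikes lie in [A], so the representations used are those of [A] with [sharp]. *)
have [invS sinvE] := star_inverse_semigroup sepA p_inj pM vE.
exists I, e, op; split=> //.
pose CS := semigroup_algebra C op.
pose F (x : A) : CS := \sum_i (g i x : C) *: sg_elt C op i.
have lFF : linear F by apply: lin_sumf => i; apply: lin_scalef; exact: gB.1.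
have Fpi i : F (p i) = sg_elt C op i.
  rewrite /F (bigD1 i) //= big1 => [|j ji]; first by rewrite gp eqxx scale1r addr0.
  by rewrite gp (negPf ji) scale0r.
have extA := @lin_ext _ A _ I (fun i x => g i x) p _ _ gB.2.
have antiextA := @semilin_ext _ Num.conj A _ I (fun i x => g i x) p _ _ gB.2.
have FM : monoid_morphism F.
  split=> [|x y]; first by rewrite -pe Fpi.
  move: x; apply: (extA) => [||i].
  - exact: lin_comp (lmull_linear y) lFF.
  - exact: lin_comp lFF (lmull_linear _).
  move: y; apply: (extA) => [||j].
  - exact: lin_comp (lmulr_linear _) lFF.
  - exact: lin_comp lFF (lmulr_linear _).
  by rewrite -pM !Fpi sg_elt_mul.
pose f : {lrmorphism A -> CS} := HB.pack F (GRing.isLinear.Build C A CS *:%R F lFF)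
  (GRing.isMonoidMorphism.Build A CS F FM).
exists f; split.
- pose G (y : CS) : A := \sum_i (y i : C) *: p i.
  have lG : linear G by apply: lin_sumf => i; apply: lin_scalef; exact: sg_coord_linear.
  have Gi i : G (sg_elt C op i) = p i by exact: sg_sum_elt.
  exists G.
    apply: (extA) => [||i /=]; [exact: lin_comp lFF lG|exact: lin_id|].
    by rewrite Fpi Gi.
  apply: sg_ext => [||i /=]; [exact: lin_comp lG lFF|exact: lin_id|].
  by rewrite Gi Fpi.
- apply: (extA) => [||i /=].
  + exact: lin_comp lFF (@sg_comul_linear _ _ _ _).
  + exact: lin_comp lD (@tmap_linear _ _ _ _ _ _ _).
  by rewrite Fpi [LHS]sg_comul_elt Dp tmapE // Fpi.
split.
- apply: (@lin_ext _ A C^o I (fun i x => g i x) p _ _ gB.2) => [||i /=].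
  + exact: lin_comp lFF (@sg_counit_linear _ _ _ _).
  + exact: lE.
  by rewrite Fpi Ep; exact: sg_counit_elt.
- apply: (antiextA) => [||i /=].
  + exact: semilin_comp lS lFF.
  + exact: comp_semilin lFF (@sg_sharp_antilinear _ _ _ _).
  by rewrite -vE !Fpi -sinvE; apply/esym; exact: sg_sharp_elt.
apply: (antiextA) => [||i /=].
- exact: semilin_comp lF lFF.
- exact: comp_semilin lFF (@sg_flat_antilinear _ _ _ _).
by rewrite Fp Fpi; apply/esym; exact: sg_flat_elt.
Qed.

End Cocommutative.

(** * Commutative bialgebras *)

Section Commutative.

Variables (C : numClosedFieldType) (A : falgType C) (D : bialgebra_data A).
Hypothesis bialgD : involutive_bialgebra D.
Hypothesis semiD : semisimple D.
Hypothesis commD : forall x y : A, x * y = y * x.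

(** The relation [g i * x = c i x *: g i] makes each [c i] multiplicative. A character [f] is
    nonzero at some [g i], since [f 1 = 1]; applying [f] to the relation and cancelling [f (g i)]
    gives [f = c i]. *)
Lemma character_basis : exists (I : finType) (c : I -> A -> C^o) (g : I -> A),
  [/\ dual_basis c g, forall i j, c i (g j) = (i == j)%:R,
      forall i, c i 1 = 1 /\ {morph c i : x y / x * y >-> x * y : C},
      forall i, sharp D (g i) = g i
    & forall f : A -> C^o, linear f -> f 1 = 1 -> {morph f : x y / x * y >-> x * y : C} ->
        exists i, c i =1 f].
Proof.
have [[_ sepA] _] := semiD.
have [g [c [lc cg cE gg gs]]] :=
  commutative_star_algebra_idempotents (@lmull_linear C A) (@mulrA A) commD (@mul1r A) sepA.
have gx i x : g i * x = (c i x : C) *: g i.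
  rewrite [in LHS](cE x) (lin_sum _ _ (lmulr_linear (g i))) (bigD1 i) //= big1 => [|j ji].
    by rewrite gg eqxx scale1r addr0.
  by rewrite gg eq_sym (negPf ji) scale0r scaler0.
have cM i : c i 1 = 1 /\ {morph c i : x y / x * y >-> x * y : C}.
  have cgE x : c i (g i * x) = c i x.
    by rewrite gx (linZ _ _ (lc i)) cg eqxx; exact: mulr1.
  split=> [|x y]; first by rewrite -cgE mulr1 cg eqxx.
  by rewrite -cgE mulrA gx -scalerAl (linZ _ _ (lc i)) cgE.
exists 'I_(dim A), c, g; split=> // f lf f1 fM.
have [i fgi] : exists i, f (g i) != 0.
  apply/existsP; apply: contraT => /existsPn fg0.
  have : f 1 = 0.
    rewrite (cE 1) (lin_sum _ _ lf) big1 // => i _.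
    by have /negPn/eqP-> := fg0 i; rewrite scaler0.
  by rewrite f1 => /eqP; rewrite oner_eq0.
exists i => x; apply: (mulfI fgi); rewrite -fM gx (linZ _ _ lf); exact: mulrC.
Qed.

Lemma commutative_dsg_iso : exists (S : finType) (e : S) (op : Monoid.law e),
  inverse_semigroup op /\ involutive_bialgebra_iso D (dsg_data C op).
Proof.
have [[coalgD D1 DM E1 EM] [lS sharpM sharpK] coinv comul_sharp flatM] := bialgD.
have [lD lE _ _ _] := coalgD; have [lF _ flatK] := coinv.
have [_ [_ sepV]] := semiD.
have [I [c [g [cB cg cM gs charP]]]] := character_basis.
have lc i : linear (c i) by case: cB.
pose ch i : 'Hom(A, C^o) := linfun (c i).
have chE i x : ch i x = c i x by exact: linfunP.
have ch_inj : injective ch.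
  move=> i j ij; have := cg i j; rewrite -[c i _]chE ij chE cg eqxx; case: eqP => // _ /eqP.
  by rewrite oner_eq0.
(* The semigroup law on characters is convolution; [charP] provides the index of the product. *)
have mulP i j : {k | ch k = dual_mul D (ch i) (ch j)}.
  apply: sig_eqW; have [||x y|k kE] := charP (fun x => tpair (c i) (c j) (comul D x)).
  - exact: lin_comp lD (@tpair_linear _ _ _ _ _).
  - by rewrite D1 tpairE // (cM i).1 (cM j).1 mulr1.
  - by rewrite DM tpair_tmul //; [case: (cM i)|case: (cM j)].
  exists k; apply/lfunP=> x; rewrite chE kE dual_mulE //.
  by apply: eq_tpair => y; rewrite chE.
(* Multiplicativity makes [flat D 1] a left unit on the range of [flat D], which is all of [A]. *)
have flat1 : flat D 1 = 1.
  by rewrite -[LHS]mulr1 -{2}[1]flatK flatM mul1r flatK.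
have lconj : antilinear (Num.conj : C^o -> C^o).
  by move=> a x y; rewrite rmorphD rmorphM.
have invP i : {k | ch k = dual_star D (ch i)}.
  apply: sig_eqW; have [||x y|k kE] := charP (fun x => Num.conj (c i (flat D x) : C) : C^o).
  - exact: (antilin_comp (semilin_comp lF (lc i)) lconj).
  - by rewrite flat1 (cM i).1 rmorph1.
  - by rewrite -flatM (cM i).2 rmorphM.
  by exists k; apply/lfunP=> x; rewrite chE kE dual_starE // chE.
have /sig_eqW[e ee] : exists e, ch e = linfun (counit D : A -> C^o).
  have [||x y|k kE] := charP (counit D) => //.
  by exists k; apply/lfunP=> x; rewrite chE kE linfunP.
pose m i j := sval (mulP i j).
have mE i j : ch (m i j) = dual_mul D (ch i) (ch j) := svalP (mulP i j).
pose v i := sval (invP i); have vE i : ch (v i) = dual_star D (ch i) := svalP (invP i).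
have [|||op opE] := @monoid_law_of I e m.
- by move=> i j k; apply: ch_inj; rewrite !mE dual_mulA.
- by move=> i; apply: ch_inj; rewrite mE ee dual_mul1l.
- by move=> i; apply: ch_inj; rewrite mE ee dual_mul1r.
have chM i j : ch (op i j) = dual_mul D (ch i) (ch j) by rewrite opE mE.
(* The characters lie in the dual, so semisimplicity of the coalgebra supplies the
   representations. *)
have [invS sinvE] := star_inverse_semigroup sepV ch_inj chM vE.
have c_op i j x : c (op i j) x = tpair (c i) (c j) (comul D x).
  by rewrite -chE chM dual_mulE //; apply: eq_tpair => y; rewrite chE.
exists I, e, op; split=> //.
pose FS := dual_semigroup_algebra C op.
(* The Gelfand transform. *)
pose F (x : A) : FS := [ffun i => c i x].
have lFF : linear F by move=> a x y; apply/ffunP=> i; rewrite !ffunE lc.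
have FM : monoid_morphism F.
  split=> [|x y]; apply/ffunP=> i; first by rewrite !ffunE (cM i).1.
  by rewrite dsg_mulE !ffunE (cM i).2.
pose f : {lrmorphism A -> FS} := HB.pack F (GRing.isLinear.Build C A FS *:%R F lFF)
  (GRing.isMonoidMorphism.Build A FS F FM).
exists f; split.
- exists (fun y : FS => \sum_i (y i : C) *: g i) => [x|y] /=.
    by rewrite [RHS](cB.2 x); apply: eq_bigr => i _; rewrite ffunE.
  apply/ffunP=> i; rewrite ffunE (lin_sum _ _ (lc i)) (bigD1 i) //= big1 => [|j ji].
    by rewrite cg eqxx addr0; exact: mulr1.
  by rewrite cg eq_sym (negPf ji) scaler0.
- move=> x; apply: dsg_tens_sep => s t; rewrite dsg_tpair_comul ffunE c_op.
  rewrite tpair_tmap //; try exact: dsg_coord_linear.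
  by apply: eq_tpair => y; rewrite ffunE.
split.
- by move=> x; rewrite /= ffunE -chE ee linfunP.
(* Both sides are antilinear, and on the self-adjoint basis [g] all character values are 0 or 1,
   hence real. *)
- apply: (@semilin_ext _ Num.conj A FS I (fun i x => c i x) g _ _ cB.2) => [||j /=].
  + exact: (semilin_comp lS lFF).
  + apply: (comp_semilin lFF) => a x y; apply/ffunP=> s.
    by rewrite !ffunE rmorphD rmorphM.
  by apply/ffunP=> i; rewrite !ffunE gs cg conjC_nat.
move=> x; apply/ffunP=> i; rewrite !ffunE sinvE.
by rewrite -[c (v i) x]chE vE dual_starE // chE conjCK.
Qed.

End Commutative.

(** [R[i]] is the field of complex numbers over the reals [R]; the four assertions are instances of
    results valid over any [numClosedFieldType]. *)
Theorem theorem2 (R : realType) :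
  (forall (S : finType) (e : S) (op : Monoid.law e), inverse_semigroup op ->
     [/\ involutive_bialgebra (sg_data R[i] op),
         semisimple (sg_data R[i] op)
       & cocommutative (sg_data R[i] op)]
     /\
     (involutive_bialgebra (dsg_data R[i] op)
      /\ forall f g : dual_semigroup_algebra R[i] op, f * g = g * f))
  /\
  ((forall (A : falgType R[i]) (D : bialgebra_data A),
      involutive_bialgebra D -> semisimple D -> cocommutative D ->
      exists (S : finType) (e : S) (op : Monoid.law e),
        inverse_semigroup op /\ involutive_bialgebra_iso D (sg_data R[i] op))
   /\
   (forall (A : falgType R[i]) (D : bialgebra_data A),
      involutive_bialgebra D -> semisimple D -> (forall x y : A, x * y = y * x) ->
      exists (S : finType) (e : S) (op : Monoid.law e),
        inverse_semigroup op /\ involutive_bialgebra_iso D (dsg_data R[i] op))).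
Proof.
split=> [S e op invS|]; split.
- split; [exact: sg_involutive_bialgebra|exact: sg_semisimple|exact: sg_cocommutative].
- by split=> [|f g]; [exact: dsg_involutive_bialgebra|exact: dsg_mulC].
- by move=> A D; exact: cocommutative_sg_iso.
by move=> A D; exact: commutative_dsg_iso.
Qed.
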